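(* Let $\mathbf{A}\in\mathbb{R}^{n\times n}$ be a nonzero symmetric positive semidefinite matrix, let $m\ge1$ be an integer (the sampling number), and let $\mu = \mathrm{tr}(\mathbf{A})/\|\mathbf{A}\|_2$ be the effective rank of $\mathbf{A}$. Then there exists $\varepsilon_{\mathrm{rel}}$ such that for all $\varepsilon\ge\varepsilon_{\mathrm{rel}}$, $$\Pr\big(|\mathrm{tr}_m^G(\mathbf{A}) - \mathrm{tr}(\mathbf{A})| \ge \varepsilon\,\mathrm{tr}(\mathbf{A})\big) \le \Pr\big(|\mathrm{tr}_m^G(\mathbf{A}_{\mathrm{rel}}) - 1| \ge \varepsilon\big) \le \Pr\big(|X-1|\ge\varepsilon\big),$$ where $X\sim\mathrm{Gamma}\big(\tfrac{m\mu}{2},\tfrac{m\mu}{2}\big)$ and $$\mathbf{A}_{\mathrm{rel}} = \frac{1}{\mu}\begin{bmatrix}\mathbf{I}_{\lfloor\mu\rfloor} & \mathbf{0} & \mathbf{0}\\ \mathbf{0} & \mu-\lfloor\mu\rfloor & \mathbf{0}\\ \mathbf{0}&\mathbf{0}&\mathbf{0}\end{bmatrix}.$$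
   Context: For a symmetric matrix $\mathbf{B}\in\mathbb{R}^{N\times N}$, the Gaussian trace estimator with $m$ samples is $\mathrm{tr}_m^G(\mathbf{B}) = \frac1m\sum_{j=1}^m \mathbf{z}_j^T\mathbf{B}\mathbf{z}_j$ with $\mathbf{z}_1,\ldots,\mathbf{z}_m$ i.i.d. standard Gaussian vectors in $\mathbb{R}^N$. $\mathbf{I}_k$ is the $k\times k$ identity; the trailing zero block of $\mathbf{A}_{\mathrm{rel}}$ may have any size (it does not affect the distribution of the estimator). $\mathrm{Gamma}(a,b)$ denotes the Gamma distribution with shape $a$ and rate $b$. *)

(* Defs.v *)
From HB Require Import structures.
From mathcomp Require Import all_boot all_order all_algebra.
From mathcomp Require Import all_classical all_reals all_analysis.
From mathcomp Require Import normal_distribution.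

Set Implicit Arguments.
Unset Strict Implicit.
Unset Printing Implicit Defensive.

Import Order.TTheory GRing.Theory Num.Theory.
Local Open Scope classical_set_scope.
Local Open Scope ring_scope.

Definition vnorm {R : realType} {n : nat} (v : 'cV[R]_n) : R :=
  Num.sqrt (\sum_(i < n) v i 0 ^+ 2).

Definition spec_norm {R : realType} {n : nat} (A : 'M[R]_n) : R :=
  sup [set vnorm (A *m v) | v in [set v : 'cV[R]_n | vnorm v = 1]].

Definition sym_psd {R : realType} {n : nat} (A : 'M[R]_n) : Prop :=
  A^T = A /\ forall v : 'cV[R]_n, 0 <= (v^T *m A *m v) 0 0.

Definition eff_rank {R : realType} {n : nat} (A : 'M[R]_n) : R :=
  \tr A / spec_norm A.

Definition trG {R : realType} {N : nat} (m : nat) (B : 'M[R]_N)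
  (z : 'I_m -> 'cV[R]_N) : R :=
  (m%:R)^-1 * \sum_(j < m) ((z j)^T *m B *m z j) 0 0.

(* Mutual independence of a finite family of real random variables:
   the product rule for every choice of measurable sets (choosing setT for
   some indices yields the product rule for every subfamily). *)
Definition mutually_independent {d} {T : measurableType d} {R : realType}
  (P : probability T R) {I : finType} (X : I -> {RV P >-> R}) : Prop :=
  forall B : I -> set R, (forall i, measurable (B i)) ->
    P (\bigcap_i (X i @^-1` B i)) = \big[*%E/1%E]_(i : I) P (X i @^-1` B i).

Definition iid_std_gaussian {d} {T : measurableType d} {R : realType}
  (P : probability T R) {I : finType} (X : I -> {RV P >-> R}) : Prop :=
  mutually_independent X /\
  forall i (A : set R), measurable A -> distribution P (X i) A = normal_prob 0 1 A.

Definition sample_vec {d} {T : measurableType d} {R : realType}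
  {P : probability T R} {m N : nat} (z : 'I_m * 'I_N -> {RV P >-> R})
  (w : T) : 'I_m -> 'cV[R]_N :=
  fun j => \col_(i < N) z (j, i) w.

Definition Gamma_fun {R : realType} (a : R) : R :=
  Rintegral lebesgue_measure `]0, +oo[%classic
    (fun x => powR x (a - 1) * expR (- x)).

Definition gamma_pdf {R : realType} (a b : R) (x : R) : R :=
  if 0 < x then powR b a * powR x (a - 1) * expR (- (b * x)) / Gamma_fun a
  else 0.

Definition gamma_prob {R : realType} (a b : R) (V : set R) : \bar R :=
  (\int[lebesgue_measure]_(x in V) (gamma_pdf a b x)%:E)%E.

Definition A_rel {R : realType} (mu : R) (k : nat) :
  'M[R]_(Num.truncn mu + (1 + k)) :=
  mu^-1 *: block_mx (1%:M : 'M[R]_(Num.truncn mu)) 0 0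
     (block_mx ((mu - (Num.truncn mu)%:R)%:M : 'M[R]_1) 0 0 (0 : 'M[R]_k)).

(* Main.v *)
Require Import Defs.
From HB Require Import structures.
From mathcomp Require Import all_boot all_order all_algebra.
From mathcomp Require Import all_classical all_reals all_analysis.
From mathcomp Require Import measurable_realfun normal_distribution.
From mathcomp Require Import ring lra.
From mathcomp Require spectral complex.

(**
By rotation invariance, the estimator of [A] divided by [tr A] is a weighted sum
of independent squared standard normals whose weights are the eigenvalues of [A]
over [m tr A], each repeated [m] times.  For [eps > 1] only the upper tail
matters, and the largest weight is [1 / (2 b)] with [b = m mu / 2] for all three
random variables involved.  If [p] eigenvalues of [A] are maximal, collecting
their contribution gives a Gamma([m p / 2], [b]) variable, and the remaining
independent part [Y] multiplies its tail asymptotically by [E exp (b Y)].  Hence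
the tail with the larger shape eventually wins: the shapes are [m p / 2],
[m floor(mu) / 2] and [m mu / 2], in increasing order.  If [p = floor(mu)] and
[d_1, d_2, ...] are the other nonzero eigenvalues over the largest one, then
[sum_i d_i] is the fractional part [r] of [mu], and the factors compare as
[prod_i (1 - d_i)^(-m/2) < (1 - r)^(-m/2)] as soon as there are two of them.
*)

Set Implicit Arguments.
Unset Strict Implicit.
Unset Printing Implicit Defensive.
Import Order.TTheory GRing.Theory Num.Theory.
Import numFieldNormedType.Exports.
Local Open Scope classical_set_scope.
Local Open Scope ring_scope.

(** * Image measures and substitutions in Lebesgue integrals *)

(** Each tail is decided by a shape, a rate and a list of weights, all read off the eigenvalues. The
    threshold is therefore fixed before the size of the zero block and the probability spaces are
    chosen. For [eps > 1] a lower deviation is impossible because the three variables are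
    nonnegative and compared with 1. The tail asymptotics carry no rate of convergence, so the
    eventual inequalities are not effective: a failure along a sequence tending to infinity
    contradicts a strict inequality between limits. Strictness is thus indispensable, and where it
    is missing the two laws coincide: in the first comparison when [p = floor(mu)] and at most one
    eigenvalue is left over, in the second when [mu] is an integer. Dominated convergence asks for
    an exponential moment of [Y] at a rate slightly above [b]; it exists because the remaining
    weights lie strictly below the largest one. The comparison of the factors is the Weierstrass
    product inequality, strict from two factors on. Normalizing constants are identified by equating
    total masses instead of being evaluated. *)

Section density.
Context d (T : measurableType d) (R : realType).
Local Open Scope ereal_scope.

(** The proofs [mg] and [g0] are parameters so that the measure structure can be attached to the
    term [mdensity mu mg g0]. *)
Definition mdensity (mu : {measure set T -> \bar R}) (g : T -> R)
    (mg : measurable_fun setT g) (g0 : forall x, (0 <= g x)%R) (V : set T) : \bar R :=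
  \int[mu]_(x in V) (g x)%:E.

Variables (mu : {measure set T -> \bar R}) (g : T -> R).
Hypotheses (mg : measurable_fun setT g) (g0 : forall x, (0 <= g x)%R).
Let mdensity0 : mdensity mu mg g0 set0 = 0.
Proof. by rewrite /mdensity integral_set0. Qed.

Let mdensity_ge0 V : 0 <= mdensity mu mg g0 V.
Proof. by apply: integral_ge0 => x _; rewrite lee_fin. Qed.

Let mdensity_sigma_additive : semi_sigma_additive (mdensity mu mg g0).
Proof.
move=> /= A mA tA mUA.
rewrite /mdensity/= ge0_integral_bigcup//=.
- by apply: is_cvg_ereal_nneg_natsum_cond => n _ _; exact: mdensity_ge0.
- have mgE : measurable_fun setT (fun x => (g x)%:E) by exact/measurable_EFinP.
  by apply: measurable_funS mgE.
- by move=> x _; rewrite lee_fin.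
Qed.

HB.instance Definition _ := isMeasure.Build _ _ _
  (mdensity mu mg g0) mdensity0 mdensity_ge0 mdensity_sigma_additive.

Import HBNNSimple.

(** Monotone convergence on both sides reduces [f] to simple functions; on the indicator of a level
    set the claim is the hypothesis on [nu]. *)
Lemma integral_density (nu : {measure set T -> \bar R}) (f : T -> \bar R) :
  (forall V, measurable V -> nu V = \int[mu]_(x in V) (g x)%:E) ->
  measurable_fun setT f -> (forall x, 0 <= f x) ->
  \int[nu]_x f x = \int[mu]_x (f x * (g x)%:E).
Proof.
move=> nuE mf f0; pose h := nnsfun_approx measurableT mf.
have -> : \int[nu]_x f x = lim (\int[nu]_x (EFin \o h n) x @[n --> \oo]).
  have fE x : f x = lim ((EFin \o h n) x @[n --> \oo]).
    by apply/esym/cvg_lim => //; apply: cvg_nnsfun_approx.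
  under eq_integral do rewrite fE.
  apply: monotone_convergence => //.
  - by move=> n; apply/measurable_EFinP/measurable_funP.
  - by move=> n x _ //=; rewrite lee_fin.
  - by move=> x _ a b ab; rewrite lee_fin; exact/lefP/nd_nnsfun_approx.
have -> : \int[mu]_x (f x * (g x)%:E) =
    lim (\int[mu]_x ((EFin \o h n) \* (EFin \o g)) x @[n --> \oo]).
  have fg x : f x * (g x)%:E = lim (((EFin \o h n) \* (EFin \o g)) x @[n --> \oo]).
    apply/esym/cvg_lim => //; apply: cvgeZr => //; exact: cvg_nnsfun_approx.
  under eq_integral do rewrite fg.
  apply: monotone_convergence => //.
  - move=> n; apply/emeasurable_funM; first exact/measurable_EFinP.
    exact/measurable_EFinP.
  - by move=> n x _ /=; rewrite mule_ge0 ?lee_fin.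
  - by move=> x _ a b ab/=; rewrite lee_wpmul2r ?lee_fin//; exact/lefP/nd_nnsfun_approx.
congr (lim (_ @ \oo)); apply/funext => n.
transitivity (\int[nu]_x
   (\sum_(y \in range (h n)) (y * \1_(h n @^-1` [set y]) x)%:E)).
  by apply: eq_integral => t tE; rewrite /= fimfunE -fsumEFin.
rewrite ge0_integral_fsum//; last 2 first.
- by move=> y; exact/measurable_EFinP/measurable_funM.
- by move=> y x _; exact: nnfun_muleindic_ge0.
transitivity (\int[mu]_x
   (\sum_(y \in range (h n)) (y * \1_(h n @^-1` [set y]) x)%:E * (g x)%:E)); last first.
  apply: eq_integral => t tE.
  by rewrite /= fimfunE -fsumEFin// ge0_mule_fsuml// => i; exact: nnfun_muleindic_ge0.
rewrite ge0_integral_fsum//; last 2 first.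
- move=> y; apply: emeasurable_funM; apply/measurable_EFinP => //.
  exact: measurable_funM.
- by move=> y x _; apply: mule_ge0; [exact: nnfun_muleindic_ge0|rewrite lee_fin].
apply: eq_fsbigr => y /set_mem [x _ <-].
have hx0 : (0 <= h n x)%R by [].
under eq_integral do rewrite EFinM.
rewrite ge0_integralZl_EFin//; last exact/measurable_EFinP.
under [RHS]eq_integral do rewrite EFinM -muleA.
rewrite ge0_integralZl_EFin//; last 2 first.
- by move=> z _; rewrite mule_ge0 ?lee_fin.
- by apply: emeasurable_funM; apply/measurable_EFinP.
congr (_ * _); rewrite integral_indic//= setIT nuE// integral_mkcond.
apply: eq_integral => z _; rewrite patchE indicE.
by case: ifPn => _; rewrite ?mul1e ?mul0e.
Qed.

End density.

Section image_measure.
Context d1 d2 (T1 : measurableType d1) (T2 : measurableType d2) (R : realType).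

(** The pushforward, packaged as a measure from a mere proof of measurability rather than from a
    bundled measurable function. *)
Definition image_measure (m : {measure set T1 -> \bar R}) (f : T1 -> T2)
    (mf : measurable_fun setT f) : {measure set T2 -> \bar R} :=
  measure_function_pushforward__canonical__measure_function_Measure m mf.

Lemma ge0_integral_image (m : {measure set T1 -> \bar R}) (f : T1 -> T2)
    (mf : measurable_fun setT f) (h : T2 -> \bar R) :
  measurable_fun setT h -> (forall y, 0 <= h y)%E ->
  (\int[image_measure m mf]_y h y = \int[m]_x h (f x))%E.
Proof. by move=> mh h0; exact: (@ge0_integral_pushforward _ _ _ _ R _ mf m setT h). Qed.

End image_measure.

Section lebesgue_substitution.
Context {R : realType}.
Local Open Scope ereal_scope.
Local Notation mu := (@lebesgue_measure R).

Lemma measurable_affine (a b : R) : measurable_fun setT (fun x : R => (a * x + b)%R).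
Proof. by apply: measurable_funD => //; apply: measurable_funM. Qed.

(** By uniqueness of Lebesgue measure it suffices that [|a|] times the image measure gives []x, y]]
    its length. A negative slope turns this interval into one closed on the left, hence the two
    cases. *)
Lemma lebesgue_measure_affine (a b : R) (A : set R) : a != 0%R -> measurable A ->
  mu ((fun x => a * x + b)%R @^-1` A) = (`|a|^-1)%:E * mu A.
Proof.
move=> a0 mA.
have na0 : (0 <= `|a|)%R by [].
have na1 : (0 < `|a|)%R by rewrite normr_gt0.
suff : mu A = `|a|%:E * mu ((fun x => a * x + b)%R @^-1` A).
  by move=> ->; rewrite muleA -EFinM mulVf ?mul1e// gt_eqF.
have mphi : measurable_fun setT (fun x : measurableTypeR R => (a * x + b)%R : measurableTypeR R).
  exact: measurable_affine.
pose nu : {measure set (measurableTypeR R) -> \bar R} :=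
  mscale (NngNum na0) (image_measure mu mphi).
apply: (@lebesgue_measure_unique _ nu) => //= _ [[x y]] _ <-.
rewrite /mscale/= /pushforward/=.
have [a_lt0|a_gt0] : (a < 0)%R \/ (0 < a)%R by lra.
  have -> : (fun x => a * x + b)%R @^-1` `]x, y] = `[(a^-1 * (y - b))%R, (a^-1 * (x - b))%R[%classic.
    apply/seteqP; split=> z /=; rewrite !in_itv/= => /andP[h1 h2]; apply/andP; split.
    - by rewrite mulrC ler_ndivrMr//; lra.
    - by rewrite mulrC ltr_ndivlMr//; lra.
    - by move: h2; rewrite mulrC ltr_ndivlMr// => ?; lra.
    - by move: h1; rewrite mulrC ler_ndivrMr// => ?; lra.
  rewrite !lebesgue_measure_itv/= !lte_fin ltr_nM2l ?invr_lt0// ltrD2r.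
  case: ifP => _; rewrite ?mule0// -!EFinD -EFinM; congr EFin.
  by rewrite ltr0_norm//; field.
have -> : (fun x => a * x + b)%R @^-1` `]x, y] = `](a^-1 * (x - b))%R, (a^-1 * (y - b))%R]%classic.
  apply/seteqP; split=> z /=; rewrite !in_itv/= => /andP[h1 h2]; apply/andP; split.
  - by rewrite mulrC ltr_pdivrMr//; lra.
  - by rewrite mulrC ler_pdivlMr//; lra.
  - by move: h1; rewrite mulrC ltr_pdivrMr// => ?; lra.
  - by move: h2; rewrite mulrC ler_pdivlMr// => ?; lra.
rewrite !lebesgue_measure_itv/= !lte_fin ltr_pM2l ?invr_gt0// ltrD2r.
case: ifP => _; rewrite ?mule0// -!EFinD -EFinM; congr EFin.
by rewrite gtr0_norm//; field.
Qed.

Lemma ge0_integral_affine (a b : R) (f : R -> \bar R) : a != 0%R ->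
  measurable_fun setT f -> (forall x, 0 <= f x) ->
  \int[mu]_x f (a * x + b)%R = (`|a|^-1)%:E * \int[mu]_x f x.
Proof.
move=> a0 mf f0.
have na0 : (0 <= `|a|^-1)%R by rewrite invr_ge0.
have mphi : measurable_fun setT (fun x : measurableTypeR R => (a * x + b)%R : measurableTypeR R).
  exact: measurable_affine.
rewrite -(ge0_integral_image mu mphi)//.
rewrite -(@ge0_integral_mscale _ _ _ mu _ measurableT (NngNum na0))//.
apply: eq_measure_integral => A mA _.
exact: lebesgue_measure_affine.
Qed.

(** The derivative of the square on the positive half-line, continued by 0 so as to be a density on
    the whole line. *)
Let dsqr (x : R) : R := (2 * Num.max x 0)%R.

Let mdsqr : measurable_fun setT dsqr.
Proof. by apply: measurable_funM => //; exact: measurable_maxr. Qed.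

Let dsqr_ge0 x : (0 <= dsqr x)%R.
Proof. by rewrite /dsqr mulr_ge0// le_max lexx orbT. Qed.

Let integral_dsqr (a b : R) : (a <= b)%R -> (0 <= a)%R ->
  \int[mu]_(x in `]a, b]) (dsqr x)%:E = (b ^+ 2 - a ^+ 2)%:E.
Proof.
rewrite le_eqVlt => /orP[/eqP-> _|ab a0].
  by rewrite set_itv_ge ?bnd_simp ?ltxx// integral_set0 subrr.
have F' (x : R) : is_derive x 1%R (fun x : R => x ^+ 2)%R (2 * x)%R.
  by apply: is_derive_eq; rewrite /= [x%:A]mulr1 -mulr2n mulr_natl.
rewrite integral_itv_obnd_cbnd; last by apply/measurable_EFinP; exact: measurable_funS mdsqr.
rewrite (@continuous_FTC2 _ _ (fun x : R => x ^+ 2)%R) ?EFinB//.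
- apply: continuous_subspaceT => x; apply: cvgM; first exact: cvg_cst.
  by apply: continuous_max; [exact: cvg_id|exact: cst_continuous].
- split.
  + by move=> x _; exact: ex_derive.
  + by apply: cvg_at_right_filter; exact: exprn_continuous.
  + by apply: cvg_at_left_filter; exact: exprn_continuous.
- move=> x; rewrite in_itv/= => /andP[ax _]; rewrite derive1E derive_val /dsqr.
  by rewrite max_l// ltW// (le_lt_trans a0).
Qed.

(** Lebesgue measure is recognized as the image under squaring of the density [dsqr], completed by
    its own restriction to the nonpositive half-line. By uniqueness this is checked on []x, y]],
    where the fundamental theorem of calculus applies to the square. *)
Lemma ge0_integral_sqr (h : R -> \bar R) :
  measurable_fun setT h -> (forall x, 0 <= h x) ->
  \int[mu]_(x in `]0%R, +oo[) h x = \int[mu]_x (h (x ^+ 2)%R * (2 * Num.max x 0)%R%:E).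
Proof.
move=> mh h0.
have msq : measurable_fun setT (fun x : measurableTypeR R => (x ^+ 2)%R : measurableTypeR R).
  exact: measurable_funX.
have mneg : measurable (`]-oo, 0%R]%classic : set (measurableTypeR R)) by exact: measurable_itv.
pose nu1 : {measure set (measurableTypeR R) -> \bar R} :=
  image_measure (mdensity mu mdsqr dsqr_ge0) msq.
pose nu : {measure set (measurableTypeR R) -> \bar R} :=
  measure_add nu1 (mrestr mu mneg).
have nu_add A : nu A = nu1 A + mrestr mu mneg A by exact: measure_addE.
have nuE A : measurable A -> mu A = nu A.
  apply: (@lebesgue_measure_unique _ nu) => //= _ [[x y]] _ <- /=.
  rewrite nu_add /nu1/= /pushforward/= /mdensity/= /mrestr/=.
  have [yx|xy] := leP y x.
    rewrite set_itv_ge ?bnd_simp -?leNgt// measure0 set0I measure0 preimage_set0.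
    by rewrite integral_set0 adde0.
  set S := (X in \int[_]_(_ in X) _); set T := `]x, y] `&` `]-oo, 0%R].
  rewrite -[X in X + _]/(\int[mu]_(x in S) (dsqr x)%:E).
  (* Since [Num.sqrt] is 0 on negative numbers, this equivalence and the next hold for endpoints of
     any sign. *)
  have sx (z : R) : (0 < z)%R -> ((x < z ^+ 2) = (Num.sqrt x < z))%R.
    move=> z0; have [x0|x0] := leP 0%R x.
      by rewrite -{1}(sqr_sqrtr x0) ltr_pXn2r// nnegrE ?sqrtr_ge0 ?ltW.
    by rewrite ltr0_sqrtr// z0 (lt_le_trans x0)// sqr_ge0.
  have sy (z : R) : (0 < z)%R -> ((z ^+ 2 <= y) = (z <= Num.sqrt y))%R.
    move=> z0; have [y0|y0] := leP 0%R y.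
      by rewrite -{1}(sqr_sqrtr y0) ler_pXn2r// nnegrE ?sqrtr_ge0 ?ltW.
    by rewrite ltr0_sqrtr// [RHS]leNgt z0 leNgt (lt_le_trans y0)// sqr_ge0.
  have -> : \int[mu]_(z in S) (dsqr z)%:E =
     \int[mu]_(z in `]Num.sqrt x, Num.sqrt y]) (dsqr z)%:E.
    rewrite integral_mkcond [RHS]integral_mkcond; apply: eq_integral => z _.
    rewrite !patchE; have [z0|z0] := leP z 0%R.
      by rewrite /dsqr max_r// mulr0; do 2 case: ifP.
    by congr (if _ then _ else _); apply/idP/idP; rewrite !inE /S/= !in_itv/= ?sx ?sy.
  rewrite integral_dsqr ?sqrtr_ge0 ?ler_wsqrtr ?(ltW xy)//.
  have [x0|x0] := leP 0%R x.
    have y0 : (0 <= y)%R by rewrite ltW// (le_lt_trans x0).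
    rewrite !sqr_sqrtr// (_ : T = set0) ?measure0 ?adde0.
      by rewrite lebesgue_measure_itv/= lte_fin xy EFinB.
    rewrite -subset0 => z [] /=; rewrite !in_itv/= => /andP[xz _] z0.
    by have := le_lt_trans x0 xz; rewrite ltNge z0.
  have -> : T = `]x, (Num.min y 0%R)]%classic.
    rewrite /T; apply/seteqP; split=> z /=; rewrite !in_itv/= le_min.
      by move=> [/andP[-> ->] ->].
    by move=> /andP[-> /andP[-> ->]].
  rewrite !lebesgue_measure_itv/= !lte_fin xy lt_min xy x0/= (ltr0_sqrtr x0) expr0n/= subr0.
  have [y0|y0] := leP 0%R y.
    by rewrite sqr_sqrtr// add0e.
  by rewrite (ltr0_sqrtr y0) expr0n/= add0e.
rewrite (eq_measure_integral nu1); last first.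
  move=> A mA Apos; have mAE := nuE A mA.
  have A0 : A `&` `]-oo, 0%R]%classic = set0.
    rewrite -subset0 => z [/Apos/=]; rewrite !in_itv/= andbT => z0.
    by rewrite leNgt z0.
  rewrite nu_add /mrestr A0 measure0 adde0 in mAE.
  exact: mAE.
rewrite integral_mkcond ge0_integral_image; last 2 first.
- apply/(measurable_restrictT _ _).1 => //; exact: measurable_funS mh.
- by move=> y; rewrite patchE; case: ifP.
have mhD : measurable_fun setT (h \_ `]0%R, +oo[).
  by apply/(measurable_restrictT _ _).1 => //; exact: measurable_funS mh.
transitivity (\int[mu]_x ((h \_ `]0%R, +oo[) (x ^+ 2)%R * (dsqr x)%:E)).
  apply: (@integral_density _ (measurableTypeR R) R mu dsqr mdsqr dsqr_ge0
    (mdensity mu mdsqr dsqr_ge0) ((h \_ `]0%R, +oo[) \o (fun x => x ^+ 2)%R)) => //.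
  - exact: (measurableT_comp mhD).
  - by move=> y; rewrite /= patchE; case: ifP.
apply: eq_integral => x _; rewrite patchE; case: ifPn => // /negP.
rewrite inE/= in_itv/= andbT => /negP; rewrite -leNgt => x20.
have -> : x = 0%R by apply/eqP; rewrite -sqrf_eq0 eq_le x20 sqr_ge0.
by rewrite /dsqr maxxx mulr0 !mule0.
Qed.

End lebesgue_substitution.

(** * Gamma laws *)

Section density_law.
Context {R : realType}.
Local Open Scope ereal_scope.
Local Notation mu := (@lebesgue_measure R).

Let idR (x : measurableTypeR R) : R := x.

Let midR : measurable_fun setT idR. Proof. by move=> _ Y mY; rewrite setTI. Qed.

HB.instance Definition _ := isMeasurableFun.Build _ _ _ _ idR midR.

(* The laws live on R with its default display, whereas the Lebesgue measure
   lives on measurableTypeR R; idR transports from the latter to the former. *)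
Definition density_law (g : R -> R) (mg : measurable_fun setT g)
    (g0 : forall x, (0 <= g x)%R) : probability R R :=
  distribution (mnormalize (mdensity mu mg g0) (dirac (0%R : measurableTypeR R))) idR.

Variables (g : R -> R) (mg : measurable_fun setT g) (g0 : forall x, (0 <= g x)%R).
Hypotheses (Kgt0 : 0 < \int[mu]_x (g x)%:E) (Kfin : \int[mu]_x (g x)%:E < +oo).

Let K := fine (\int[mu]_x (g x)%:E).

Let K_gt0 : (0 < K)%R. Proof. by rewrite fine_gt0// Kgt0. Qed.

Lemma integral_density_law (f : R -> \bar R) :
  measurable_fun setT f -> (forall x, 0 <= f x) ->
  \int[density_law mg g0]_x f x = (K^-1)%:E * \int[mu]_x (f x * (g x)%:E).
Proof.
move=> mf f0.
have K1ge0 : (0 <= K^-1)%R by rewrite invr_ge0 ltW.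
rewrite ge0_integral_distribution//.
pose g' x := (K^-1 * g x)%R.
have mg' : measurable_fun setT g' by exact: measurable_funM.
have g'0 x : (0 <= g' x)%R by rewrite mulr_ge0.
rewrite (@integral_density _ (measurableTypeR R) R mu g' mg' g'0); last 3 first.
- move=> V mV; rewrite /= /mnormalize /= /mdensity.
  rewrite gt_eqF//= lt_eqF//=.
  under [RHS]eq_integral do rewrite EFinM.
  rewrite ge0_integralZl//; last 2 first.
  - by apply/measurable_EFinP; exact: measurable_funS mg.
  - by move=> x _; rewrite lee_fin.
  by rewrite muleC.
- exact: mf.
- by move=> x; exact: f0.
rewrite -ge0_integralZl//; last 2 first.
- by apply: emeasurable_funM => //; exact/measurable_EFinP.
- by move=> x _; rewrite mule_ge0// lee_fin.
by apply: eq_integral => x _; rewrite EFinM muleCA.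
Qed.

End density_law.

Section gamma_weight.
Context {R : realType}.
Implicit Types a b x : R.
Local Notation mu := (@lebesgue_measure R).

(** The Gamma density without its constant. The rate 0 is allowed: it gives the bare powers that
    occur in the Beta integral and in the substitution by the square. *)
Definition gw a b x : R := if 0 < x then x `^ (a - 1) * expR (- (b * x)) else 0.

Lemma gw_ge0 a b x : 0 <= gw a b x.
Proof. by rewrite /gw; case: ifP => // _; rewrite mulr_ge0 ?powR_ge0 ?expR_ge0. Qed.

Lemma measurable_gw a b : measurable_fun setT (gw a b).
Proof.
rewrite (_ : gw a b = fun x => x `^ (a - 1) * expR (- (b * x)) * \1_`]0, +oo[ x); last first.
  apply/funext => x; rewrite /gw indicE; case: ifPn => x0.
    by rewrite mem_set ?mulr1//= in_itv/= x0.
  by rewrite memNset ?mulr0//= in_itv/= (negbTE x0).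
apply: measurable_funM => //; apply: measurable_funM; first exact: measurable_powR.
apply: measurableT_comp => //; apply: measurableT_comp => //.
Qed.

Definition Kg a b : \bar R := (\int[mu]_x (gw a b x)%:E)%E.

Lemma Kg_scale a b : 0 < b -> Kg a b = ((b `^ (- a))%:E * Kg a 1)%E.
Proof.
move=> b0; have bn0 : b != 0 by rewrite gt_eqF.
have H : (\int[mu]_x (gw a 1 (b * x + 0))%:E = (b^-1)%:E * Kg a 1)%E.
  have := @ge0_integral_affine R b 0 (EFin \o gw a 1) bn0. rewrite gtr0_norm//; apply.
  - apply/measurable_EFinP; exact: measurable_gw.
  - by move=> x; rewrite lee_fin gw_ge0.
have -> : Kg a b = ((b `^ (1 - a))%:E * \int[mu]_x (gw a 1 (b * x + 0))%:E)%E.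
  rewrite -ge0_integralZl//=; last 3 first.
  - by apply/measurable_EFinP; apply: (measurableT_comp (measurable_gw a 1)); exact: measurable_affine.
  - by move=> x _; rewrite lee_fin gw_ge0.
  - by rewrite lee_fin powR_ge0.
  apply: eq_integral => x _; rewrite -EFinM; congr EFin.
  rewrite /gw addr0 pmulr_rgt0//; case: ifPn => [x0|]; last by rewrite mulr0.
  rewrite mul1r powRM ?ltW// !mulrA -powRD; last by rewrite bn0 implybT.
  by rewrite (_ : 1 - a + (a - 1) = 0) ?powRr0 ?mul1r//; ring.
rewrite H muleA -EFinM; congr ((_)%:E * _)%E.
rewrite -(powR_inv1 (ltW b0)) -powRD; last by rewrite bn0 implybT.
by congr (_ `^ _); ring.
Qed.

Lemma powR_le_expR (s c : R) : 0 <= s -> 0 < c ->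
  exists2 M : R, 0 < M & forall x, 0 < x -> x `^ s <= M * expR (c * x).
Proof.
move=> s0 c0; pose n := (Num.truncn s).+1.
(* The summand 1 serves [x <= 1]. Beyond 1, [x ^ s] is at most [x ^ n], which is bounded through the
   term of degree [n] of the exponential series. *)
exists (1 + n`!%:R / c ^+ n).
  by rewrite ltr_pwDl// divr_ge0// exprn_ge0// ltW.
move=> x x0; have cx0 : 0 <= c * x by rewrite mulr_ge0// ltW.
have e1 : 1 <= expR (c * x) by rewrite -expR0 ler_expR.
rewrite mulrDl mul1r.
have [x1|x1] := leP x 1.
  apply: (@le_trans _ _ (1 `^ s)); first by rewrite ge0_ler_powR// nnegrE ?ltW.
  rewrite powR1.
  by rewrite (le_trans e1)// lerDl mulr_ge0 ?expR_ge0// divr_ge0// exprn_ge0// ltW.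
rewrite (@le_trans _ _ (x ^+ n))//.
  rewrite -powR_mulrn ?(ltW x0)//; apply: ler_powR; first exact: ltW.
  by have := truncnS_gt s; exact: ltW.
rewrite (@le_trans _ _ (n`!%:R / c ^+ n * expR (c * x)))//; last first.
  by rewrite lerDr expR_ge0.
rewrite -mulrA mulrCA ler_pdivlMl ?exprn_gt0// mulrC -exprMn_comm; last exact: mulrC.
have := @expR_ge1Dxn R (c * x) n.-1 cx0; rewrite /n/= => h.
rewrite -ler_pdivrMl ?ltr0n ?fact_gt0//.
apply: le_trans h; rewrite mulrC (mulrC c); lra.
Qed.

End gamma_weight.

(** * Squares of Gaussian variables and the weight of shape 1/2 *)

Section gauss_square.
Context {R : realType}.
Local Open Scope ereal_scope.
Local Notation mu := (@lebesgue_measure R).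

(** The two half-lines contribute equally by parity, and on each one [u = x ^ 2] produces the
    density [u ^ (-1/2) / 2]. *)
Lemma ge0_integral_comp_sqr (H : R -> \bar R) :
  measurable_fun setT H -> (forall x, 0 <= H x) ->
  \int[mu]_x H (x ^+ 2)%R = \int[mu]_x (H x * (gw 2^-1 0 x)%:E).
Proof.
move=> mH H0.
have msq : measurable_fun setT (fun x : R => (x ^+ 2)%R) by exact: measurable_funX.
have mF : measurable_fun setT (fun x : R => H (x ^+ 2)%R) by exact: measurableT_comp.
pose h u := H u * (2^-1 * gw 2^-1 0 u)%:E.
have mh : measurable_fun setT h.
  apply: emeasurable_funM => //; apply/measurable_EFinP; apply: measurable_funM => //.
  exact: measurable_gw.
have h0 x : 0 <= h x by rewrite mule_ge0// lee_fin mulr_ge0// gw_ge0.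
have half : \int[mu]_(x in `]0%R, +oo[) H (x ^+ 2)%R = \int[mu]_x h x.
  transitivity (\int[mu]_(x in `]0%R, +oo[) h x).
    rewrite [RHS]ge0_integral_sqr// [LHS]integral_mkcond; apply: eq_integral => x _.
    rewrite patchE; case: ifPn; rewrite ?inE ?notin_setE/= in_itv/= andbT.
      move=> x0; rewrite /h -muleA -EFinM /gw exprn_gt0// mul0r oppr0 expR0 mulr1.
      rewrite max_l ?(ltW x0)// (_ : 2^-1 - 1 = - 2^-1 :> R)%R; last by field.
      rewrite powRN powR12_sqrt ?sqr_ge0// sqrtr_sqr gtr0_norm//.
      rewrite (_ : 2^-1 / x * (2 * x) = 1)%R ?mule1//.
      by field; rewrite gt_eqF.
    by move=> /negP; rewrite -leNgt => x0; rewrite max_r// mulr0 mule0.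
  rewrite integral_mkcond; apply: eq_integral => x _.
  rewrite patchE; case: ifPn; rewrite ?inE ?notin_setE//= in_itv/= andbT => /negP.
  by rewrite /h /gw => /negbTE ->; rewrite mulr0 mule0.
have -> : \int[mu]_x H (x ^+ 2)%R =
  \int[mu]_(x in `]0%R, +oo[) H (x ^+ 2)%R + \int[mu]_(x in `]0%R, +oo[) H (x ^+ 2)%R.
  rewrite -(setUv (`]0%R, +oo[%classic : set R)) ge0_integral_setU//=; last 3 first.
  - exact: measurableC.
  - by rewrite setUv.
  - exact/disj_setPCl.
  congr (_ + _); rewrite setCitvr.
  have /= := @ge0_integration_by_substitution0 R (fun x => H (x ^+ 2)%R) mF (fun x => H0 _).
  under [in RHS]eq_integral do rewrite sqrrN.
  move=> <-; rewrite integral_itv_obnd_cbnd//.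
  exact: measurable_funS mF.
rewrite half -ge0_integralD//; apply: eq_integral => x _.
rewrite /h -ge0_muleDr ?lee_fin ?mulr_ge0 ?gw_ge0//.
by rewrite -EFinD; congr (_ * _%:E); field.
Qed.

Let phi := normal_pdf 0 (1 : R).

Let mphi : measurable_fun setT phi. Proof. exact: measurable_normal_pdf. Qed.

Let phi0 x : (0 <= phi x)%R. Proof. exact: normal_pdf_ge0. Qed.

(** This is the analytic form of the fact that [w g ^ 2] follows Gamma(1/2, 1/(2w)) for a standard
    normal [g]: the Gaussian density is a function of the square, and scaling by [w] changes the
    rate. *)
Lemma ge0_integral_gauss_sqr (w : R) (f : R -> \bar R) : (0 < w)%R ->
  measurable_fun setT f -> (forall x, 0 <= f x) ->
  \int[mu]_x (f (w * x ^+ 2)%R * (phi x)%:E) =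
  (normal_peak 1 * w `^ (- 2^-1))%:E * \int[mu]_x (f x * (gw 2^-1 (2 * w)^-1 x)%:E).
Proof.
move=> w0 mf f0.
have p0 : (0 <= normal_peak (1 : R))%R by exact: normal_peak_ge0.
have mfw : measurable_fun setT (fun x : R => f (w * x)%R).
  by apply: (measurableT_comp mf) => //; exact: measurable_funM.
pose H u := f (w * u)%R * (normal_peak 1 * expR (- (u / 2)))%:E.
transitivity (\int[mu]_x H (x ^+ 2)%R).
  apply: eq_integral => x _; rewrite /H /phi normal_pdfE ?oner_eq0// /normal_fun.
  by rewrite subr0 expr1n mulNr.
have mH : measurable_fun setT H.
  apply: emeasurable_funM => //; apply/measurable_EFinP; apply: measurable_funM => //.
  apply: measurableT_comp => //; apply: measurableT_comp => //.
  exact: measurable_funM.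
have H0 x : 0 <= H x by rewrite mule_ge0// lee_fin mulr_ge0// expR_ge0.
rewrite ge0_integral_comp_sqr//.
pose G v := f v * (gw 2^-1 (2 * w)^-1 v)%:E.
have mG : measurable_fun setT G.
  by apply: emeasurable_funM => //; apply/measurable_EFinP; exact: measurable_gw.
have G0 x : 0 <= G x by rewrite mule_ge0// lee_fin gw_ge0.
have wn0 : w != 0%R by rewrite gt_eqF.
have := ge0_integral_affine 0 wn0 mG G0.
rewrite gtr0_norm// => HG.
transitivity ((normal_peak 1 * w `^ (2^-1))%:E * \int[mu]_x G (w * x + 0)%R); last first.
  rewrite HG muleA -EFinM; congr (_%:E * _).
  rewrite -mulrA; congr (_ * _)%R; rewrite -(powR_inv1 (ltW w0)) -powRD; last by rewrite wn0 implybT.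
  by congr (_ `^ _)%R; field.
rewrite -ge0_integralZl//; last 2 first.
- by apply: (measurableT_comp mG); exact: measurable_affine.
- by rewrite lee_fin mulr_ge0// powR_ge0.
apply: eq_integral => x _; rewrite /H /G addr0 -muleA [RHS]muleCA; congr (_ * _).
rewrite -!EFinM; congr EFin; rewrite -!mulrA; congr (_ * _)%R.
rewrite /gw pmulr_rgt0//; case: ifPn => [x0|]; last by rewrite !mulr0.
rewrite mul0r oppr0 expR0 mulr1 powRM ?(ltW w0) ?(ltW x0)//.
have E : (w `^ 2^-1 * w `^ (2^-1 - 1) = 1)%R.
  rewrite -powRD; last by rewrite wn0 implybT.
  by rewrite (_ : 2^-1 + (2^-1 - 1) = 0)%R ?powRr0//; field.
rewrite -[in RHS]mulrA [RHS]mulrA E mul1r mulrC; congr (_ * expR _)%R.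
by field.
Qed.

End gauss_square.

Section gamma_law.
Context {R : realType}.
Implicit Types a b x : R.
Local Notation mu := (@lebesgue_measure R).

Lemma gw_lb a b x : 0 <= a -> 0 <= b -> 1 < x <= 2 -> 2^-1 * expR (- (b * 2)) <= gw a b x.
Proof.
move=> a0 b0 /andP[x1 x2]; have x0 : 0 < x by rewrite (lt_trans _ x1).
rewrite /gw x0 ler_pM ?invr_ge0 ?expR_ge0//; last first.
  by rewrite ler_expR lerN2 ler_wpM2l.
apply: (@le_trans _ _ (x `^ (- 1))).
  by rewrite powR_inv1 ?(ltW x0)// lef_pV2 ?posrE.
by rewrite ler_powR ?(ltW x1)//; lra.
Qed.

Lemma Kg_gt0 a b : 0 <= a -> 0 <= b -> (0 < Kg a b)%E.
Proof.
move=> a0 b0; pose c : R := 2^-1 * expR (- (b * 2)).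
have c0 : 0 < c by rewrite mulr_gt0 ?invr_gt0 ?expR_gt0.
apply: (@lt_le_trans _ _ (\int[mu]_(x in `]1%R, 2%R]) c%:E)%E).
  rewrite integral_cst//= lebesgue_measure_itv/= lte_fin ltr1n -EFinB -EFinM lte_fin.
  by rewrite mulr_gt0// subr_gt0 ltr1n.
apply: (@le_trans _ _ (\int[mu]_(x in `]1%R, 2%R]) (gw a b x)%:E)%E).
  apply: ge0_le_integral => //.
  - by move=> x _; rewrite lee_fin ltW.
  - by apply/measurable_EFinP; exact: measurable_funS (measurable_gw a b).
  - by move=> x; rewrite /= in_itv/= lee_fin; exact: gw_lb.
apply: ge0_subset_integral => //.
- by apply/measurable_EFinP; exact: measurable_gw.
- by move=> x _; rewrite lee_fin gw_ge0.
Qed.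

(** The Gaussian density has mass 1, and with [w = 1/(2b)] this mass is a positive multiple of
    [Kg 2^-1 b]. *)
Lemma Kg_half_fin b : 0 < b -> (Kg 2^-1 b < +oo)%E.
Proof.
move=> b0; have b2 : 0 < (2 * b)^-1 by rewrite invr_gt0 mulr_gt0.
have := @ge0_integral_gauss_sqr R (2 * b)^-1 (cst 1%E) b2 (measurable_cst _) (fun=> lee01).
under eq_integral do rewrite mul1e.
under [in X in _ = X]eq_integral do rewrite mul1e.
rewrite integral_normal_pdf.
have -> : (2 * (2 * b)^-1)^-1 = b by field; rewrite gt_eqF.
rewrite -/(Kg _ _) => K1.
rewrite ltey; apply/negP => /eqP K0; move: K1; rewrite K0 gt0_muley//.
by rewrite lte_fin mulr_gt0 ?powR_gt0 ?normal_peak_gt0 ?oner_eq0.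
Qed.

(** Half of the rate absorbs the excess power [x ^ (a - 1/2)], which reduces the claim to shape 1/2.
    The bound 1/2 on the shape covers every Gamma law of the proof, since [m >= 1] and [mu >= 1]. *)
Lemma Kg_fin a b : 2^-1 <= a -> 0 < b -> (Kg a b < +oo)%E.
Proof.
move=> a2 b0; have b2 : 0 < b / 2 by rewrite divr_gt0.
have s0 : 0 <= a - 2^-1 by rewrite subr_ge0.
have [M M0 HM] := powR_le_expR s0 b2.
apply: (@le_lt_trans _ _ (M%:E * Kg 2^-1 (b / 2))%E); last first.
  by rewrite lte_mul_pinfty ?lee_fin ?ltW// Kg_half_fin.
rewrite -ge0_integralZl//; last 3 first.
- by apply/measurable_EFinP; exact: measurable_gw.
- by move=> x _; rewrite lee_fin gw_ge0.
- by rewrite lee_fin ltW.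
apply: ge0_le_integral => //.
- by move=> x _; rewrite lee_fin gw_ge0.
- by apply/measurable_EFinP; exact: measurable_gw.
- by apply/measurable_EFinP; apply: measurable_funM => //; exact: measurable_gw.
move=> x _; rewrite -EFinM lee_fin /gw; case: ifPn => x0; last by rewrite mulr0.
have xn0 : x != 0 by rewrite gt_eqF.
have -> : a - 1 = (a - 2^-1) + (2^-1 - 1) by ring.
rewrite powRD ?xn0 ?implybT//.
rewrite mulrAC [leRHS]mulrCA [leRHS]mulrC ler_wpM2r ?powR_ge0//.
have -> : - (b * x) = - (b / 2 * x) - b / 2 * x by field.
rewrite expRD mulrA [leRHS]mulrC [leRHS]mulrC ler_wpM2r ?expR_ge0// expRN ler_pdivrMr ?expR_gt0//.
exact: HM.
Qed.

(** A probability for all parameters: the normalization falls back on a Dirac mass when the total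
    weight is 0 or infinite. The weight is known to be normalizable for [a >= 1/2] and [b > 0]. *)
Definition gamma_law a b : probability R R := density_law (measurable_gw a b) (gw_ge0 a b).

Variables (a b : R).
Hypotheses (a_ge : 2^-1 <= a) (b_gt0 : 0 < b).

Let a_ge0 : 0 <= a. Proof. by rewrite (le_trans _ a_ge). Qed.

Lemma Kg_fin_num : Kg a b \is a fin_num.
Proof. by rewrite ge0_fin_numE ?Kg_fin// ltW// Kg_gt0// ltW. Qed.

Lemma integral_gamma_law (f : R -> \bar R) :
  measurable_fun setT f -> (forall x, 0 <= f x)%E ->
  (\int[gamma_law a b]_x f x = ((fine (Kg a b))^-1)%:E * \int[mu]_x (f x * (gw a b x)%:E))%E.
Proof.
by move=> mf f0; rewrite integral_density_law ?Kg_gt0 ?Kg_fin// ltW.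
Qed.

Lemma gamma_lawE (A : set R) : measurable A ->
  (gamma_law a b A = ((fine (Kg a b))^-1)%:E * \int[mu]_(x in A) (gw a b x)%:E)%E.
Proof.
move=> mA; rewrite -[A in LHS]setIT -(integral_indic _ measurableT mA) integral_gamma_law//.
- congr (_ * _)%E; rewrite [RHS]integral_mkcond; apply: eq_integral => x _.
  by rewrite patchE indicE; case: ifP; rewrite ?mul1e ?mul0e.
- by apply/measurable_EFinP.
Qed.

Lemma gamma_probE (A : set R) : measurable A -> gamma_prob a b A = gamma_law a b A.
Proof.
move=> mA.
have K1 : Gamma_fun a = fine (Kg a 1).
  rewrite /Gamma_fun /Rintegral; congr fine; rewrite integral_mkcond.
  apply: eq_integral => x _; rewrite /gw patchE; case: ifPn.
    by rewrite inE/= in_itv/= andbT => ->; rewrite mul1r.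
  by rewrite notin_setE/= in_itv/= andbT => /negP/negbTE ->.
have KE : fine (Kg a b) = b `^ (- a) * Gamma_fun a.
  by rewrite K1 Kg_scale// fineM// ge0_fin_numE ?Kg_fin// ltW// Kg_gt0.
rewrite gamma_lawE// -ge0_integralZl//; last 3 first.
- by apply/measurable_EFinP; exact: measurable_funS (measurable_gw a b).
- by move=> x _; rewrite lee_fin gw_ge0.
- by rewrite lee_fin invr_ge0 fine_ge0// ltW// Kg_gt0// ltW.
apply: eq_integral => x _; rewrite -EFinM; congr EFin.
rewrite /gamma_pdf /gw KE; case: ifP => _; last by rewrite mulr0.
by rewrite invfM -powRN opprK mulrAC -!mulrA; congr (_ * _); rewrite mulrCA.
Qed.

End gamma_law.

(** * Sums of independent Gamma variables and their exponential moments *)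

Section gamma_add.
Context {R : realType}.
Implicit Types a b x : R.
Local Notation mu := (@lebesgue_measure R).

(** With rate 0 the weights are bare powers, so this is the Beta integral B(a, a'), kept as an
    extended real. *)
Let betac a a' : \bar R := (\int[mu]_u (gw a 0 u * gw a' 0 (1 - u))%:E)%E.

Let betac_ge0 a a' : (0 <= betac a a')%E.
Proof. by apply: integral_ge0 => x _; rewrite lee_fin mulr_ge0 ?gw_ge0. Qed.

Lemma measurable_gw_sub a b z : measurable_fun setT (fun x => gw a b (z - x)).
Proof.
apply: (measurableT_comp (measurable_gw a b)).
by apply: measurable_funB.
Qed.

(** Because the rates agree, the exponentials multiply to one depending on [z] only; [x = z u] then
    extracts the power of [z] and leaves the Beta integral. *)
Lemma gw_conv a a' b z : 
  (\int[mu]_x (gw a b x * gw a' b (z - x))%:E = betac a a' * (gw (a + a') b z)%:E)%E.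
Proof.
have [z0|z0] := leP z 0.
  rewrite [gw (a + a') b z]/gw ltNge z0/= mule0 integral0_eq// => x _.
  congr EFin; rewrite /gw; case: ifPn => [x0|]; last by rewrite mul0r.
  by rewrite subr_gt0 ltNge (le_trans z0 (ltW x0)) mulr0.
have zn0 : z != 0 by rewrite gt_eqF.
pose G x := ((gw a b x * gw a' b (z - x))%:E : \bar R).
have mG : measurable_fun setT G.
  apply/measurable_EFinP; apply: measurable_funM; first exact: measurable_gw.
  exact: measurable_gw_sub.
have G0 x : (0 <= G x)%E by rewrite lee_fin mulr_ge0 ?gw_ge0.
have := ge0_integral_affine 0 zn0 mG G0; rewrite gtr0_norm// => HG.
have -> : (\int[mu]_x G x = z%:E * \int[mu]_x G (z * x + 0)%R)%E.
  by rewrite HG muleA -EFinM mulfV// mul1e.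
rewrite muleC /betac -ge0_integralZr//; last 2 first.
- by apply: (measurableT_comp mG); exact: measurable_affine.
- by rewrite lee_fin ltW.
rewrite -ge0_integralZr//; last 3 first.
- apply/measurable_EFinP; apply: measurable_funM; first exact: measurable_gw.
  exact: measurable_gw_sub.
- by move=> x _; rewrite lee_fin mulr_ge0 ?gw_ge0.
- by rewrite lee_fin gw_ge0.
apply: eq_integral => x _; rewrite /G addr0 -!EFinM; congr EFin.
rewrite /gw pmulr_rgt0// z0; case: ifPn => [x0|]; last by rewrite !mul0r.
have -> : z - z * x = z * (1 - x) by ring.
rewrite pmulr_rgt0//; case: ifPn => [x1|]; last by rewrite !(mulr0,mul0r).
rewrite !mul0r oppr0 expR0 !mulr1 !powRM ?(ltW z0) ?(ltW x0) ?(ltW x1)//.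
have -> : z `^ (a + a' - 1) = z `^ (a - 1) * z `^ (a' - 1) * z.
  rewrite -{4}(powRr1 (ltW z0)) -!powRD ?zn0 ?implybT//.
  by congr (_ `^ _); ring.
have -> : expR (- (b * z)) = expR (- (b * (z * x))) * expR (- (b * (z * (1 - x)))).
  by rewrite -expRD; congr expR; ring.
by ring.
Qed.

Let lebZl (k : \bar R) (F : R -> \bar R) : (0 <= k)%E ->
  measurable_fun setT F -> (forall x, 0 <= F x)%E ->
  (\int[mu]_x (k * F x) = k * \int[mu]_x F x)%E.
Proof.
move=> k0 mF F0.
exact: (@ge0_integralZl _ (measurableTypeR R) R mu _ measurableT F mF k (fun x _ => F0 x) k0).
Qed.

Let conv_integral a a' b (f : R -> \bar R) :
  measurable_fun setT f -> (forall x, 0 <= f x)%E ->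
  (\int[mu]_x (\int[mu]_y (f (x + y)%R * (gw a' b y)%:E) * (gw a b x)%:E) =
   betac a a' * \int[mu]_z (f z * (gw (a + a') b z)%:E))%E.
Proof.
move=> mf f0.
pose h (xz : measurableTypeR R * measurableTypeR R) :=
  (f xz.2 * (gw a' b (xz.2 - xz.1) * gw a b xz.1)%:E)%E.
have mh : measurable_fun setT h.
  apply: emeasurable_funM; first exact: (measurableT_comp mf).
  apply/measurable_EFinP; apply: measurable_funM.
    apply: (measurableT_comp (measurable_gw a' b)).
    by apply: measurable_funB.
  exact: (measurableT_comp (measurable_gw a b)).
have h0 xz : (0 <= h xz)%E by rewrite mule_ge0// lee_fin mulr_ge0 ?gw_ge0.
transitivity (\int[mu]_x \int[mu]_z h (x, z))%E.
  apply: eq_integral => x _.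
  pose F z := (f z * (gw a' b (z - x))%:E)%E.
  have mF : measurable_fun setT F.
    apply: emeasurable_funM => //; apply/measurable_EFinP.
    apply: (measurableT_comp (measurable_gw a' b)).
    by apply: measurable_funB.
  have F0 z : (0 <= F z)%E by rewrite mule_ge0// lee_fin gw_ge0.
  have := ge0_integral_affine x (oner_neq0 R) mF F0.
  rewrite normr1 invr1 mul1e => HF.
  have -> : (\int[mu]_y (f (x + y)%R * (gw a' b y)%:E) = \int[mu]_z F z)%E.
    by rewrite -HF; apply: eq_integral => y _; rewrite /F mul1r (addrC y) (addrC x) addrK addrC.
  have gwx0 : (0 <= (gw a b x)%:E)%E by rewrite lee_fin gw_ge0.
  transitivity (\int[mu]_z (F z * (gw a b x)%:E))%E.
    apply/esym/(@ge0_integralZr _ (measurableTypeR R) R mu _ measurableT F mF).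
    - by move=> z _; exact: F0.
    - exact: gwx0.
  by apply: eq_integral => z _; rewrite /F /h/= -muleA.
rewrite fubini_tonelli//.
have mfg : measurable_fun setT (fun z => f z * (gw (a + a') b z)%:E)%E.
  by apply: emeasurable_funM => //; apply/measurable_EFinP; exact: measurable_gw.
have fg0 z : (0 <= f z * (gw (a + a') b z)%:E)%E by rewrite mule_ge0// lee_fin gw_ge0.
rewrite -(lebZl (betac_ge0 a a') mfg fg0).
apply: eq_integral => z _; rewrite muleCA -gw_conv.
have mgg : measurable_fun setT (fun x => (gw a b x * gw a' b (z - x))%:E).
  apply/measurable_EFinP; apply: measurable_funM; first exact: measurable_gw.
  exact: measurable_gw_sub.
have gg0 x : (0 <= (gw a b x * gw a' b (z - x))%:E)%E by rewrite lee_fin mulr_ge0 ?gw_ge0.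
rewrite -(lebZl (f0 z) mgg gg0).
by apply: eq_integral => x _; rewrite /h/= (mulrC (gw a b x)).
Qed.

Opaque gamma_law.

Lemma product_measure_integral (m1 m2 : probability R R) (A : set (R * R)) :
  measurable A ->
  ((m1 \x m2) A = \int[m1]_x \int[m2]_y (\1_A (x, y))%:E)%E.
Proof.
move=> mA; rewrite -[A in LHS]setIT -(integral_indic _ measurableT mA).
by rewrite fubini_tonelli1//; exact/measurable_EFinP.
Qed.

Lemma measurable_add2 : measurable_fun setT (fun xy : R * R => xy.1 + xy.2).
Proof. by apply: measurable_funD. Qed.

(* Both sides have densities proportional to gw (a + a') b, so the unknown Beta
   factor is fixed by the total masses. *)
Lemma gamma_law_add a a' b (B : set R) : 2^-1 <= a -> 2^-1 <= a' -> 0 < b ->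
  measurable B ->
  ((gamma_law a b \x gamma_law a' b) ((fun xy : R * R => xy.1 + xy.2)%R @^-1` B) =
   gamma_law (a + a') b B)%E.
Proof.
move=> a2 a2' b0 mB.
have aa2 : 2^-1 <= a + a' by rewrite (le_trans a2)// lerDl (le_trans _ a2').
have K0 c : 2^-1 <= c -> 0 < fine (Kg c b).
  move=> c2; rewrite fine_gt0// Kg_fin// Kg_gt0 ?(ltW b0)//.
  by rewrite (le_trans _ c2).
pose C := (((fine (Kg a b))^-1 * (fine (Kg a' b))^-1)%:E * betac a a' *
     (fine (Kg (a + a') b))%:E)%E.
have key f : measurable_fun setT f -> (forall x, 0 <= f x)%E ->
    (\int[gamma_law a b]_x \int[gamma_law a' b]_y f (x + y)%R =
     C * \int[gamma_law (a + a') b]_z f z)%E.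
  move=> mf f0.
  have mfx x : measurable_fun setT (fun y => f (x + y)).
    by apply: (measurableT_comp mf); exact: measurable_funD.
  pose h (xy : R * R) := f (xy.1 + xy.2).
  have mh : measurable_fun setT h by exact: (measurableT_comp mf measurable_add2).
  pose J x := (\int[gamma_law a' b]_y h (x, y))%E.
  have mJ : measurable_fun setT J.
    exact: (@measurable_fun_fubini_tonelli_F _ _ R R R (gamma_law a' b) h mh (fun=> f0 _)).
  have J0 x : (0 <= J x)%E by apply: integral_ge0 => y _; exact: f0.
  have JE x : (J x = ((fine (Kg a' b))^-1)%:E * \int[mu]_y (f (x + y)%R * (gw a' b y)%:E))%E.
    exact: (integral_gamma_law a2' b0 (mfx x) (fun y => f0 _)).
  transitivity (\int[gamma_law a b]_x J x)%E; first by [].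
  etransitivity; first exact: (integral_gamma_law a2 b0 mJ J0).
  have E2 := integral_gamma_law aa2 b0 mf f0.
  transitivity (C * (((fine (Kg (a + a') b))^-1)%:E *
      \int[mu]_z (f z * (gw (a + a') b z)%:E)))%E; last by congr (_ * _)%E; exact: esym E2.
  rewrite {E2} muleA.
  have -> : (C * ((fine (Kg (a + a') b))^-1)%:E =
      ((fine (Kg a b))^-1 * (fine (Kg a' b))^-1)%:E * betac a a')%E.
    by rewrite /C -muleA -EFinM mulfV ?mule1// gt_eqF// K0.
  rewrite -[RHS]muleA -conv_integral// EFinM -[RHS]muleA; congr (_ * _)%E.
  pose I x := (\int[mu]_y (f (x + y)%R * (gw a' b y)%:E))%E.
  have mI : measurable_fun setT (fun x => I x * (gw a b x)%:E)%E.
    apply: emeasurable_funM; last by apply/measurable_EFinP; exact: measurable_gw.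
    apply: (@measurable_fun_fubini_tonelli_F _ _ (measurableTypeR R) (measurableTypeR R) R mu
      (fun xy => f (xy.1 + xy.2)%R * (gw a' b xy.2)%:E)%E) => //.
    + apply: emeasurable_funM; first exact: (measurableT_comp mf measurable_add2).
      by apply/measurable_EFinP; apply: (measurableT_comp (measurable_gw a' b)).
    + by move=> xy; rewrite mule_ge0// lee_fin gw_ge0.
  have I0 x : (0 <= I x * (gw a b x)%:E)%E.
    rewrite mule_ge0// ?lee_fin ?gw_ge0// integral_ge0// => y _.
    by rewrite mule_ge0// lee_fin gw_ge0.
  have K0' : (0 <= ((fine (Kg a' b))^-1)%:E :> \bar R)%E by rewrite lee_fin invr_ge0 ltW// K0.
  rewrite -(lebZl K0' mI I0).
  by apply: eq_integral => x _; rewrite JE muleA.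
have C1 : C = 1%E.
  have k1 := key (cst 1%E) (measurable_cst _) (fun=> lee01).
  have one (p : probability R R) : (\int[p]_x cst 1%E x = 1)%E.
    by rewrite integral_cst// mul1e; exact: probability_setT.
  have L1 (p q : probability R R) : (\int[p]_x \int[q]_y cst 1%E (x + y)%R = 1)%E.
    by rewrite -[RHS](one p); apply: eq_integral => x _; exact: one.
  rewrite -[LHS]mule1 -[in LHS](one (gamma_law (a + a') b)).
  exact: etrans (esym k1) (L1 _ _).
have mpre : measurable ((fun xy : R * R => xy.1 + xy.2) @^-1` B).
  by rewrite -[X in measurable X]setTI; exact: measurable_add2.
rewrite product_measure_integral//.
rewrite -[B in RHS]setIT -(integral_indic _ measurableT mB).
have mI : measurable_fun setT (fun x : R => (\1_B x : R)%:E) by exact/measurable_EFinP.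
have I0 x : (0 <= (\1_B x : R)%:E)%E by rewrite lee_fin.
have kB := key _ mI I0; rewrite C1 mul1e in kB.
exact: kB.
Qed.

(** Exponential tilting lowers the rate to [b - c], so the moment is a quotient of two normalizing
    constants. *)
Lemma integral_expR_gamma_law a b c : 2^-1 <= a -> 0 < b -> c < b ->
  (\int[gamma_law a b]_x (expR (c * x))%:E = ((b / (b - c)) `^ a)%:E)%E.
Proof.
move=> a2 b0 cb; have bc0 : 0 < b - c by rewrite subr_gt0.
have a0 : 0 <= a by rewrite (le_trans _ a2).
have me : measurable_fun setT (fun x : R => (expR (c * x))%:E).
  apply/measurable_EFinP; apply: (measurableT_comp (@measurable_expR R)).
  exact: mulrl_measurable.
rewrite integral_gamma_law//.
have -> : (\int[mu]_x ((expR (c * x))%:E * (gw a b x)%:E) = Kg a (b - c))%E.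
  apply: eq_integral => x _; rewrite -EFinM; congr EFin.
  rewrite /gw; case: ifP => _; rewrite ?mulr0// mulrCA -expRD; congr (_ * expR _).
  by ring.
rewrite (Kg_scale _ bc0) (Kg_scale _ b0) fineM//; last exact: Kg_fin_num.
have K1 : 0 < fine (Kg a 1) by rewrite fine_gt0// Kg_fin// Kg_gt0.
rewrite -[X in (_ * (_ * X))%E](@fineK _ (Kg a 1)) ?Kg_fin_num// -!EFinM; congr EFin.
rewrite powRM ?invr_ge0 ?(ltW b0) ?(ltW bc0)// !powRN.
rewrite -(powR_inv1 (ltW bc0)) -powRrM mulN1r powRN.
rewrite [fine (_%:E)]/=; move: K1; set k := fine _ => K1.
by field; rewrite !gt_eqF ?powR_gt0.
Qed.

End gamma_add.

(** * Tail asymptotics *)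

Section tail.
Context {R : realType}.
Implicit Types a b x y t k : R.
Local Notation mu := (@lebesgue_measure R).

(** Real-valued, so that ratios of tails can be formed; [wtailE] leads back to the integral for
    admissible parameters. *)
Definition wtail a b t : R := fine (\int[mu]_(x in `[t, +oo[) (gw a b x)%:E)%E.

Let mgwE a b (D : set R) : measurable_fun D (fun x => (gw a b x)%:E).
Proof. by apply/measurable_EFinP; exact: measurable_funS (measurable_gw a b). Qed.

Let gwE0 a b x : (0 <= (gw a b x)%:E)%E.
Proof. by rewrite lee_fin gw_ge0. Qed.

Lemma wtailE a b t : 2^-1 <= a -> 0 < b ->
  ((wtail a b t)%:E = \int[mu]_(x in `[t, +oo[) (gw a b x)%:E)%E.
Proof.
move=> a2 b0; rewrite fineK// ge0_fin_numE; last exact: integral_ge0.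
apply: le_lt_trans (Kg_fin a2 b0).
by apply: ge0_subset_integral => //; exact: mgwE.
Qed.

Lemma gamma_law_tail a b t : 2^-1 <= a -> 0 < b ->
  gamma_law a b `[t, +oo[%classic = ((fine (Kg a b))^-1 * wtail a b t)%:E.
Proof. by move=> a2 b0; rewrite gamma_lawE// -wtailE. Qed.

Lemma wtail_shift a b t y : 2^-1 <= a -> 0 < b ->
  ((wtail a b (t - y))%:E = \int[mu]_(x in `[t, +oo[) (gw a b (x - y))%:E)%E.
Proof.
move=> a2 b0; rewrite wtailE// integral_mkcond.
have mD (D : set R) : measurable D -> measurable_fun setT ((fun x => (gw a b x)%:E) \_ D).
  by move=> mD; apply/(measurable_restrictT _ _).1 => //; exact: mgwE.
have D0 (D : set R) x : (0 <= ((fun x => (gw a b x)%:E) \_ D) x)%E.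
  by rewrite patchE; case: ifP.
have mI : measurable (`[(t - y)%R, +oo[%classic : set R) by exact: measurable_itv.
have := ge0_integral_affine (- y) (oner_neq0 R) (mD _ mI) (D0 _).
rewrite normr1 invr1 mul1e => <-.
rewrite [RHS]integral_mkcond; apply: eq_integral => x _.
rewrite !patchE mul1r; congr (if _ then _ else _).
by apply/idP/idP; rewrite !inE/= !in_itv/= !andbT lerD2r.
Qed.

(** Translation brings both tails onto the half-line from [t], so tail estimates become pointwise
    comparisons of weights there. *)
Lemma wtail_le a a' b t y y' k : 2^-1 <= a -> 2^-1 <= a' -> 0 < b -> 0 <= k ->
  (forall x, t <= x -> gw a b (x - y) <= k * gw a' b (x - y')) ->
  wtail a b (t - y) <= k * wtail a' b (t - y').
Proof.
move=> a2 a2' b0 k0 H; rewrite -lee_fin EFinM !wtail_shift//.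
have mg c z (D : set R) : measurable_fun D (fun x => (gw c b (x - z))%:E).
  apply/measurable_EFinP; apply: (@measurable_funS _ _ _ _ setT) => //.
  apply: (measurableT_comp (measurable_gw c b)); exact: measurable_funB.
rewrite -ge0_integralZl//; last exact: mg.
apply: ge0_le_integral => //.
- exact: mg.
- by apply: emeasurable_funM => //; exact: mg.
- by move=> x /=; rewrite in_itv/= andbT -EFinM lee_fin; exact: H.
Qed.

Lemma wtail_gt0 a b t : 2^-1 <= a -> 0 < b -> 0 < wtail a b t.
Proof.
move=> a2 b0; rewrite -lte_fin wtailE//.
pose m := Num.max 1 t.
have m0 : 0 < m + 1 by rewrite ltr_wpDl// le_max ler01.
pose c : R := (m + 1)^-1 * expR (- (b * (m + 1))).
have c0 : 0 < c by rewrite mulr_gt0 ?invr_gt0 ?expR_gt0.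
apply: (@lt_le_trans _ _ (\int[mu]_(x in `]m, (m + 1)%R]) c%:E)%E).
  rewrite integral_cst//= lebesgue_measure_itv/= lte_fin ltrDl ltr01 -EFinB -EFinM lte_fin.
  by rewrite mulr_gt0// addrAC subrr add0r.
apply: (@le_trans _ _ (\int[mu]_(x in `]m, (m + 1)%R]) (gw a b x)%:E)%E).
  apply: ge0_le_integral => //.
  - by move=> x _; rewrite lee_fin ltW.
  - exact: mgwE.
  - move=> x; rewrite /= in_itv/= lee_fin => /andP[mx xm].
    have x1 : 1 <= x by rewrite ltW// (le_lt_trans _ mx)// le_max lexx.
    have x0 : 0 < x by rewrite (lt_le_trans _ x1).
    rewrite /gw x0 ler_pM ?invr_ge0 ?expR_ge0 ?(ltW m0)//; last first.
      by rewrite ler_expR lerN2 ler_wpM2l// ltW.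
    apply: (@le_trans _ _ (x `^ (- 1))).
      by rewrite powR_inv1 ?(ltW x0)// lef_pV2 ?posrE.
    by rewrite ler_powR//; lra.
apply: ge0_subset_integral => //; first exact: mgwE.
move=> x; rewrite /= !in_itv/= andbT => /andP[mx _].
by rewrite (le_trans _ (ltW mx))// le_max lexx orbT.
Qed.

Lemma wtail_nonincr a b t t' : 2^-1 <= a -> 0 < b -> t <= t' -> wtail a b t' <= wtail a b t.
Proof.
move=> a2 b0 tt; rewrite -lee_fin !wtailE//; apply: ge0_subset_integral => //.
- exact: mgwE.
- by move=> x; rewrite /= !in_itv/= !andbT; exact: le_trans.
Qed.

Lemma wtail_le_Kg a b t : 2^-1 <= a -> 0 < b -> wtail a b t <= fine (Kg a b).
Proof.
move=> a2 b0; rewrite -lee_fin wtailE// fineK ?Kg_fin_num//.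
by apply: ge0_subset_integral => //; exact: mgwE.
Qed.

(** The quotient of the weights is [x ^ (a' - a)], at least [t ^ (a' - a)] on the tail. This growth
    is what makes the larger shape win. *)
Lemma wtail_exponent a a' b t : 2^-1 <= a -> a <= a' -> 0 < b -> 0 < t ->
  t `^ (a' - a) * wtail a b t <= wtail a' b t.
Proof.
move=> a2 aa b0 t0; have a2' := le_trans a2 aa.
rewrite -ler_pdivlMl ?powR_gt0// -[t]subr0 [X in _ * wtail _ _ X]/(t - 0).
apply: wtail_le => //; first by rewrite invr_ge0 powR_ge0.
move=> x tx; rewrite !subr0 ler_pdivlMl ?powR_gt0//.
have x0 : 0 < x by rewrite (lt_le_trans t0).
rewrite /gw x0 mulrA ler_wpM2r ?expR_ge0//.
have -> : x `^ (a' - 1) = x `^ (a' - a) * x `^ (a - 1).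
  rewrite -powRD ?(gt_eqF x0) ?implybT//.
  by congr (_ `^ _); ring.
rewrite ler_wpM2r ?powR_ge0//.
by rewrite ge0_ler_powR ?nnegrE ?subr_ge0 ?(ltW t0) ?(ltW x0).
Qed.

(** For fixed [y] the power factor tends to 1 as [x] grows, so a shift by [y] asymptotically
    multiplies the weight by [exp (b y)]. *)
Lemma gw_shift a b x y : 0 < x -> 0 < x - y ->
  gw a b (x - y) = expR (b * y) * (1 - y / x) `^ (a - 1) * gw a b x.
Proof.
move=> x0 xy0; rewrite /gw x0 xy0.
have -> : - (b * (x - y)) = b * y - b * x by ring.
rewrite expRD.
have {1}-> : x - y = (1 - y / x) * x by field; rewrite gt_eqF.
have r0 : 0 <= 1 - y / x.
  have -> : 1 - y / x = (x - y) / x by field; rewrite gt_eqF.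
  by rewrite divr_ge0 ?ltW.
by rewrite powRM ?(ltW x0)//; ring.
Qed.

(** As [a - 1 >= -1], the power factor of [gw_shift] is at most [x / (x - y) = 1 + y / (x - y)], and
    [x - y >= 1] on the tail. *)
Lemma wtail_sub_le a b t y : 2^-1 <= a -> 0 < b -> 0 <= y -> 1 <= t - y ->
  wtail a b (t - y) <= expR (b * y) * (1 + y) * wtail a b t.
Proof.
move=> a2 b0 y0 ty; rewrite -{2}[t]subr0.
have k0 : 0 <= expR (b * y) * (1 + y) by rewrite mulr_ge0 ?expR_ge0// addr_ge0.
apply: wtail_le => // x tx; rewrite subr0.
have xy1 : 1 <= x - y by rewrite (le_trans ty)// lerD2r.
have xy0 : 0 < x - y by rewrite (lt_le_trans _ xy1).
have x0 : 0 < x by rewrite (lt_le_trans xy0)// gerBl.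
rewrite gw_shift// ler_wpM2r ?gw_ge0// ler_wpM2l ?expR_ge0//.
set r := 1 - y / x.
have rE : r = (x - y) / x by rewrite /r; field; rewrite gt_eqF.
have r0 : 0 < r by rewrite rE divr_gt0.
have r1 : r <= 1 by rewrite /r gerBl divr_ge0// ltW.
apply: (@le_trans _ _ (r `^ (- 1))).
  by apply: ger_powR; [rewrite r0 r1|lra].
rewrite powR_inv1 ?(ltW r0)// rE invf_div ler_pdivrMr//.
nra.
Qed.

(* The dominating function for [convolution_tail_cvg]: the rate [c > b] absorbs
   the polynomial factors. *)
Lemma wtail_ratio_bound a b c : 2^-1 <= a -> 0 < b -> b < c ->
  exists2 M : R, 0 <= M & forall t y, 1 <= t ->
    wtail a b (t - y) / wtail a b t <= 1 + M * expR (c * y).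
Proof.
move=> a2 b0 bc.
have T0 := wtail_gt0 _ a2 b0.
have cb0 : 0 < c - b by rewrite subr_gt0.
(* [D] is designed for [t - y < 1], where the shifted tail is bounded only by the total mass:
   [D * wtail a b 1] exceeds that mass. *)
pose D := 1 + fine (Kg a b) / wtail a b 1.
have D1 : 1 <= D by rewrite lerDl divr_ge0 ?(ltW (T0 _))// fine_ge0// ltW// Kg_gt0; lra.
have M0 : 0 <= 1 + (c - b)^-1 by rewrite addr_ge0// invr_ge0 ltW.
exists (D * (1 + (c - b)^-1)); first by rewrite mulr_ge0// (le_trans _ D1).
move=> t y t1; rewrite ler_pdivrMr//.
have [y0|y0] := ltP y 0.
  rewrite (@le_trans _ _ (1 * wtail a b t))//.
    by rewrite mul1r wtail_nonincr//; lra.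
  rewrite ler_wpM2r ?(ltW (T0 _))// lerDl mulr_ge0 ?expR_ge0// mulr_ge0//.
  by rewrite (le_trans _ D1).
have yM : 1 + y <= (1 + (c - b)^-1) * expR ((c - b) * y).
  apply: (@le_trans _ _ ((1 + (c - b)^-1) * (1 + (c - b) * y))).
    rewrite mulrDl mul1r mulrDr mulr1 [X in _ <= _ + (_ + X)]mulrA mulVf ?gt_eqF// mul1r.
    have : 0 <= (c - b) * y by rewrite mulr_ge0// ltW.
    have : 0 <= (c - b)^-1 by rewrite invr_ge0 ltW.
    by lra.
  by rewrite ler_wpM2l// expR_ge1Dx.
have Ey : expR (b * y) * (1 + y) <= (1 + (c - b)^-1) * expR (c * y).
  have -> : c * y = b * y + (c - b) * y by ring.
  by rewrite expRD mulrCA ler_wpM2l ?expR_ge0.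
suff H : wtail a b (t - y) <= D * (expR (b * y) * (1 + y)) * wtail a b t.
  apply: (le_trans H); rewrite ler_wpM2r ?(ltW (T0 _))//.
  rewrite -mulrA; apply: (@le_trans _ _ (D * ((1 + (c - b)^-1) * expR (c * y)))).
    by rewrite ler_wpM2l// (le_trans _ D1).
  by rewrite lerDr.
have [yt|yt] := leP 1 (t - y).
  rewrite (le_trans (wtail_sub_le a2 b0 y0 yt))// ler_wpM2r ?(ltW (T0 _))//.
  by rewrite ler_peMl// mulr_ge0 ?expR_ge0// addr_ge0.
(* Now [y > t - 1]. The shift by [t - 1], which leads from [t] down to 1, still satisfies
   [wtail_sub_le], and its factor increases with the shift. *)
have E0 : expR (b * (t - 1)) * t <= expR (b * y) * (1 + y).
  by rewrite ler_pM ?expR_ge0 ?ler_expR ?ler_wpM2l//; lra.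
have H1 : wtail a b 1 <= expR (b * (t - 1)) * t * wtail a b t.
  have := @wtail_sub_le a b t (t - 1) a2 b0.
  rewrite (_ : t - (t - 1) = 1); last by ring.
  rewrite (_ : 1 + (t - 1) = t); last by ring.
  by apply; lra.
apply: (@le_trans _ _ (D * wtail a b 1)); last first.
  rewrite -mulrA ler_wpM2l// ?(le_trans _ D1)//.
  by rewrite (le_trans H1)// ler_wpM2r ?(ltW (T0 _)).
rewrite /D mulrDl mul1r divfK ?gt_eqF//.
apply: (le_trans (wtail_le_Kg _ a2 b0)). by rewrite lerDr ltW.
Qed.

Lemma powR_cvg1 (p y : R) : (1 - y / x) `^ p @[x --> +oo] --> (1 : R).
Proof.
have h1 : 1 - y / x @[x --> +oo] --> (1 : R).
  rewrite -[X in _ --> X]subr0; apply: cvgB; first exact: cvg_cst.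
  rewrite -(mulr0 y); apply: cvgM; first exact: cvg_cst.
  by apply/gtr0_cvgV0; [exact: nbhs_pinfty_gt|exact: cvg_id].
have c1 : {for (1 : R), continuous (fun z : R => z `^ p)}.
  apply: differentiable_continuous; apply/derivable1_diffP.
  by apply: derivable_powR; rewrite in_itv/= ltr01.
by have := cvg_comp _ _ h1 c1; rewrite powR1.
Qed.

(** Once [t] is large, the power factor of [gw_shift] is within [d] of 1 at every [x >= t];
    integration preserves both bounds. *)
Lemma wtail_ratio_cvg a b y : 2^-1 <= a -> 0 < b ->
  wtail a b (t - y) / wtail a b t @[t --> +oo] --> expR (b * y).
Proof.
move=> a2 b0; apply/cvgrPdist_le => e e0.
have E0 := expR_gt0 (b * y).
(* The cap at 1 keeps [1 - d] nonnegative; for [d = 1] the lower bound below is trivial. *)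
pose d := Num.min (e / expR (b * y)) 1.
have d0 : 0 < d by rewrite lt_min divr_gt0/=.
have dE : expR (b * y) * d <= e by rewrite mulrC -ler_pdivlMr// ge_min lexx.
have d1 : d <= 1 by rewrite ge_min lexx orbT.
have /cvgrPdist_le/(_ _ d0) [M [_ HM]] := @powR_cvg1 (a - 1) y.
near=> t.
have tM : M < t by near: t; apply: nbhs_pinfty_gt; rewrite num_real.
have t0 : 0 < t by near: t; apply: nbhs_pinfty_gt; rewrite num_real.
have ty : y < t by near: t; apply: nbhs_pinfty_gt; rewrite num_real.
have T0 : 0 < wtail a b t by exact: wtail_gt0.
have H x : t <= x -> [/\ 0 < x, 0 < x - y & 1 - d <= (1 - y / x) `^ (a - 1) <= 1 + d].
  move=> tx; split.
  - by rewrite (lt_le_trans t0).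
  - by rewrite subr_gt0 (lt_le_trans ty).
  - have := HM _ (lt_le_trans tM tx); rewrite ler_norml.
    by move=> /andP[h1 h2]; apply/andP; split; lra.
have up : wtail a b (t - y) <= expR (b * y) * (1 + d) * wtail a b t.
  rewrite -{2}[t]subr0; apply: wtail_le => //.
    by rewrite mulr_ge0 ?(ltW E0)// addr_ge0// ltW.
  move=> x /H[x0 xy0 /andP[_ h]]; rewrite subr0 gw_shift//.
  by rewrite ler_wpM2r ?gw_ge0// ler_wpM2l// ltW.
have lo : expR (b * y) * (1 - d) * wtail a b t <= wtail a b (t - y).
  have [d11|d11] := eqVneq d 1; first by rewrite d11 subrr mulr0 mul0r ltW// wtail_gt0.
  have d1' : 0 < 1 - d by rewrite subr_gt0 lt_neqAle d11.
  rewrite -ler_pdivlMl; last by rewrite mulr_gt0.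
  rewrite -{1}[t]subr0; apply: wtail_le => //.
    by rewrite invr_ge0 ltW// mulr_gt0.
  move=> x /H[x0 xy0 /andP[h _]]; rewrite subr0 ler_pdivlMl ?mulr_gt0// gw_shift//.
  by rewrite ler_wpM2r ?gw_ge0// ler_wpM2l// ltW.
apply: le_trans dE; rewrite ler_norml; apply/andP; split.
- rewrite lerBrDl -lerBrDr opprK ler_pdivrMr//.
  by apply: (le_trans up); rewrite le_eqVlt; apply/orP; left; apply/eqP; ring.
- rewrite lerBlDl -lerBlDr ler_pdivlMr//.
  by apply: le_trans lo; rewrite le_eqVlt; apply/orP; left; apply/eqP; ring.
Unshelve. all: by end_near.
Qed.

End tail.

(** * Tail of a Gamma variable plus an independent variable *)

Section convolution_tail.
Context {R : realType}.
Local Notation mu := (@lebesgue_measure R).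
Variables (a b c : R) (nu : probability R R).
Hypotheses (a2 : 2^-1 <= a) (b0 : 0 < b) (bc : b < c).
Hypothesis nuc : (\int[nu]_y (expR (c * y))%:E < +oo)%E.

Definition addge (t : R) : set (R * R) := [set xy | t <= xy.1 + xy.2].

Lemma measurable_addge t : measurable (addge t).
Proof.
rewrite (_ : addge t = (fun xy : R * R => xy.1 + xy.2) @^-1` `[t, +oo[).
  by rewrite -[X in measurable X]setTI; exact: measurable_add2.
by apply/seteqP; split => x; rewrite /addge/= in_itv/= andbT.
Qed.

Lemma gamma_law_addge t :
  ((gamma_law a b \x nu) (addge t) =
   \int[nu]_y ((fine (Kg a b))^-1 * wtail a b (t - y))%:E)%E.
Proof.
rewrite -[addge t]setIT -(integral_indic _ measurableT (measurable_addge t)).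
rewrite fubini_tonelli2//; last first.
  by apply/measurable_EFinP; apply: measurable_indic; exact: measurable_addge.
apply: eq_integral => y _.
transitivity (gamma_law a b `[t - y, +oo[%classic); last exact: gamma_law_tail.
rewrite -[X in _ = gamma_law a b X]setIT -(integral_indic _ measurableT)//.
apply: eq_integral => x _; rewrite !indicE.
suff -> : ((x, y) \in addge t) = (x \in `[t - y, +oo[%classic) by [].
by apply/idP/idP; rewrite !inE /addge/= in_itv/= andbT lerBlDr.
Qed.

Let mexp (k : R) : measurable_fun setT (fun y : R => (expR (k * y))%:E).
Proof.
apply/measurable_EFinP; apply: (measurableT_comp (@measurable_expR R)).
exact: mulrl_measurable.
Qed.

(** Conditioning on [y], the normalized tail is the integral of
    [wtail a b (u n - y) / wtail a b (u n)]. Each ratio tends to [exp (b y)] and is dominated by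
    [1 + M exp (c y)], integrable by [nuc]. The statement is sequential to fit dominated
    convergence. *)
Lemma convolution_tail_cvg (u : nat -> R) : (forall n, 1 <= u n) ->
  u @ \oo --> +oo ->
  ((fine (Kg a b) / wtail a b (u n))%:E * (gamma_law a b \x nu) (addge (u n)))%E @[n --> \oo]
    --> (\int[nu]_y (expR (b * y))%:E)%E.
Proof.
move=> u1 uoo.
have K0 : 0 < fine (Kg a b).
  by rewrite fine_gt0// Kg_fin// Kg_gt0 ?(ltW b0)// (le_trans _ a2).
have T0 t := wtail_gt0 t a2 b0.
have [M M0 HM] := wtail_ratio_bound a2 b0 bc.
pose f n y := (wtail a b (u n - y) / wtail a b (u n))%:E.
have mf n : measurable_fun setT (f n).
  apply/measurable_EFinP; apply: measurable_funM => //.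
  apply: nondecreasing_measurable => //.
  by move=> x y xy; apply: wtail_nonincr => //; lra.
rewrite (_ : (fun n => _) = (fun n => \int[nu]_y f n y)%E); last first.
  apply/funext => n; rewrite gamma_law_addge -ge0_integralZl//.
  - apply: eq_integral => y _; rewrite -EFinM /f; congr EFin.
    by field; rewrite !gt_eqF.
  - apply/measurable_EFinP; apply: measurable_funM => //.
    apply: nondecreasing_measurable => //.
    by move=> x y xy; apply: wtail_nonincr => //; lra.
  - by move=> y _; rewrite lee_fin mulr_ge0 ?invr_ge0 ?(ltW K0) ?(ltW (T0 _)).
  - by rewrite lee_fin divr_ge0 ?(ltW K0) ?(ltW (T0 _)).
have mg : measurable_fun setT (fun y : R => (1 + M * expR (c * y))%:E).
  apply/measurable_EFinP; apply: measurable_funD => //; apply: measurable_funM => //.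
  exact: (measurableT_comp (@measurable_expR R) (@mulrl_measurable R setT c)).
have g0 y : 0 <= 1 + M * expR (c * y) by rewrite addr_ge0// mulr_ge0// expR_ge0.
have cf : {ae nu, forall y, setT y -> f ^~ y @ \oo --> (expR (b * y))%:E}.
  apply/aeW => y _; apply: cvg_EFin; first exact: nearW.
  exact: (cvg_comp _ _ uoo (@wtail_ratio_cvg _ a b y a2 b0)).
have ig : nu.-integrable setT (fun y : R => (1 + M * expR (c * y))%:E).
  apply/integrableP; split => //.
  under eq_integral do rewrite /= ger0_norm ?g0//.
  under eq_integral do rewrite EFinD EFinM.
  rewrite ge0_integralD//; last 2 first.
  - by move=> y _; rewrite -EFinM lee_fin mulr_ge0// expR_ge0.
  - by apply: emeasurable_funM.
  rewrite integral_cst// mul1e.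
  rewrite lte_add_pinfty//; first by rewrite (le_lt_trans (probability_le1 _ _))// ltry.
  have e0 y : [set: R] y -> (0 <= (expR (c * y))%:E)%E by rewrite lee_fin expR_ge0.
  by rewrite (ge0_integralZl _ measurableT (mexp c) e0)// lte_mul_pinfty.
have fg : {ae nu, forall y n, setT y -> (`|f n y| <= (1 + M * expR (c * y))%:E)%E}.
  apply/aeW => y n _; rewrite /f abse_EFin lee_fin ger0_norm; first exact: HM.
  by rewrite divr_ge0// ltW.
by have [_ _] := dominated_convergence measurableT mf (mexp b) cf ig fg.
Qed.

End convolution_tail.

(** * Independence, convolution and the standard normal law *)

Section independence.
Context d (T : measurableType d) (R : realType) (P : probability T R) (I : finType).
Implicit Types (X : I -> T -> R) (nu : I -> probability R R) (B : I -> set R).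
Local Open Scope ereal_scope.

(** Independence and marginal laws share one product formula, so that a transformation of the
    variables transports both at once. *)
Definition indep_laws X nu := (forall i, measurable_fun setT (X i)) /\
  forall B, (forall i, measurable (B i)) ->
    P (\bigcap_i (X i @^-1` B i)) = \prod_(i : I) nu i (B i).

Lemma indep_laws_law X nu i A : indep_laws X nu -> measurable A ->
  P (X i @^-1` A) = nu i A.
Proof.
move=> [mX H] mA; pose B k := if k == i then A else setT.
have mB k : measurable (B k) by rewrite /B; case: ifP.
have := H B mB; rewrite (bigD1 i)//= /B eqxx big1 ?mule1; last first.
  by move=> k /negbTE ->; exact: probability_setT.
move=> <-; congr (P _); apply/seteqP; split=> w /=.
  by move=> Aw k _ /=; case: ifP => // /eqP ->.
by move=> /(_ i Logic.I) /=; rewrite eqxx.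
Qed.

Lemma indep_laws_comp X nu nu' (g : I -> R -> R) :
  (forall i, measurable_fun setT (g i)) ->
  (forall i A, measurable A -> nu i (g i @^-1` A) = nu' i A) ->
  indep_laws X nu -> indep_laws (fun i => g i \o X i) nu'.
Proof.
move=> mg E [mX H]; split=> [i|B mB]; first exact: measurableT_comp.
have mB' i : measurable (g i @^-1` B i).
  by rewrite -[X in measurable X]setTI; exact: mg.
have := H (fun i => g i @^-1` B i) mB' => /= ->.
by apply: eq_bigr => i _; rewrite E.
Qed.

Variables (X : I -> T -> R) (nu : I -> probability R R) (i j : I).
Hypotheses (XI : indep_laws X nu) (ij : i != j).

Let mX k : measurable_fun setT (X k). Proof. by have [mX _] := XI; exact: mX. Qed.

Let mpair : measurable_fun setT (fun w => (X i w, X j w)).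
Proof. exact: measurable_fun_pair. Qed.

Let off B : set T := \bigcap_(k in [set k | (k != i) && (k != j)]) (X k @^-1` B k).

Let measurable_off B : (forall k, measurable (B k)) -> measurable (off B).
Proof.
move=> mB; apply: fin_bigcap_measurable; first exact: finite_finset.
by move=> k _; rewrite -[X in measurable X]setTI; exact: mX.
Qed.

(** With the constraints on the other coordinates frozen, the left side is a measure in [C] that
    agrees on rectangles with [p] times the product measure; uniqueness of the product measure
    extends this to all [C]. *)
Lemma indep_laws_pair B (C : set (R * R)) : (forall k, measurable (B k)) -> measurable C ->
  P (off B `&` (fun w => (X i w, X j w)) @^-1` C) =
  (nu i \x nu j) C * \prod_(k | (k != i) && (k != j)) nu k (B k).
Proof.
move=> mB mC; set p := \prod_(k | _) _.
have p0 : 0 <= p by rewrite /p; elim/big_ind: _ => // *; exact: mule_ge0.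
have p1 : p <= 1.
  have /andP[] // : (0 <= p) && (p <= 1).
  rewrite /p; elim/big_ind: _ => // [|x y /andP[x0 x1] /andP[y0 y1]|k _].
  - by rewrite lee01 lexx.
  - by rewrite mule_ge0//= -[leRHS]mule1 lee_pmul.
  - by rewrite measure_ge0 probability_le1.
have mO := measurable_off mB.
pose m : {measure set (R * R) -> \bar R} := image_measure (mrestr P mO) mpair.
have mE D : m D = P ((fun w => (X i w, X j w)) @^-1` D `&` off B) by [].
have rect A A' : measurable A -> measurable A' -> m (A `*` A') = nu i A * nu j A' * p.
  move=> mA mA'; rewrite mE.
  pose B' k := if k == i then A else if k == j then A' else B k.
  have mB' k : measurable (B' k) by rewrite /B'; case: ifP => // _; case: ifP.
  have [_ /(_ B' mB')] := XI; rewrite (bigD1 i)//= (bigD1 j) 1?eq_sym//= muleA.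
  have -> : B' i = A by rewrite /B' eqxx.
  have -> : B' j = A' by rewrite /B' eqxx eq_sym (negbTE ij).
  have -> : \prod_(k | (k != i) && (k != j)) nu k (B' k) = p.
    by apply: eq_bigr => k /andP[/negbTE ki /negbTE kj]; rewrite /B' ki kj.
  move=> <-; congr (P _); apply/seteqP; split=> w /=.
    move=> [[Aw A'w] Ow] k _ /=; rewrite /B'.
    have [->//|ki] := eqVneq k i; have [->//|kj] := eqVneq k j.
    by apply: Ow; rewrite /= ki kj.
  move=> H; split; first split.
  - by have := H i Logic.I; rewrite /= /B' eqxx.
  - by have := H j Logic.I; rewrite /= /B' eqxx eq_sym (negbTE ij).
  - move=> k /= /andP[/negbTE ki /negbTE kj].
    by have := H k Logic.I; rewrite /= /B' ki kj.
rewrite setIC -mE.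
have pfin : p \is a fin_num by rewrite ge0_fin_numE// (le_lt_trans p1)// ltry.
(* Uniqueness is applied to the measure divided by [p]. When [p] is 0 the total mass of [m] vanishes
   and both sides are 0. *)
have [pz|pn0] := eqVneq p 0.
  rewrite pz mule0; apply/eqP; rewrite eq_le measure_ge0 andbT.
  have <- : m (setT `*` setT) = 0 by rewrite rect// pz mule0.
  by apply: le_measure; rewrite ?inE// setXTT.
have fp0 : (0 < fine p)%R by rewrite fine_gt0// lt0e pn0 p0/= ltey_eq pfin.
have fp1 : (0 <= (fine p)^-1)%R by rewrite invr_ge0 ltW.
have pp : ((fine p)^-1)%:E * p = 1.
  by rewrite -[X in _ * X](fineK pfin) -EFinM mulVf// gt_eqF.
rewrite (@product_measure_unique _ _ _ _ _ (nu i) (nu j) (mscale (NngNum fp1) m))//.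
  by rewrite /mscale/= muleAC pp mul1e.
move=> A A' mA mA'; transitivity (((fine p)^-1)%:E * m (A `*` A')); first by [].
by rewrite rect// muleCA pp mule1.
Qed.

(** The elementary move on a family: two coordinates are replaced by two functions of them that are
    independent under the product law. It serves both for plane rotations and for adding one
    coordinate to another. *)
Lemma indep_laws_pair_map (S1 S2 : R * R -> R) (n1 n2 : probability R R) :
  measurable_fun setT S1 -> measurable_fun setT S2 ->
  (forall A A', measurable A -> measurable A' ->
    (nu i \x nu j) (S1 @^-1` A `&` S2 @^-1` A') = n1 A * n2 A') ->
  indep_laws (fun k => if k == i then fun w => S1 (X i w, X j w)
                       else if k == j then fun w => S2 (X i w, X j w) else X k)
             (fun k => if k == i then n1 else if k == j then n2 else nu k).
Proof.
move=> mS1 mS2 H; split=> [k|B mB].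
  case: ifP => _; first exact: measurableT_comp mS1 mpair.
  by case: ifP => // _; exact: measurableT_comp mS2 mpair.
pose C := S1 @^-1` B i `&` S2 @^-1` B j.
have mC : measurable C.
  apply: measurableI; rewrite -[X in measurable X]setTI; [exact: mS1|exact: mS2].
rewrite (bigD1 i)//= (bigD1 j) 1?eq_sym//= muleA eqxx eq_sym (negbTE ij) eqxx.
rewrite -H//.
have -> : \prod_(k | (k != i) && (k != j))
    (if k == i then n1 else if k == j then n2 else nu k) (B k) =
    \prod_(k | (k != i) && (k != j)) nu k (B k).
  by apply: eq_bigr => k /andP[/negbTE -> /negbTE ->].
rewrite -indep_laws_pair//; congr (P _); apply/seteqP; split=> w /=.
  move=> Hw; split.
    move=> k /= /andP[/negbTE ki /negbTE kj].
    by have := Hw k Logic.I; rewrite /= ki kj.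
  split; first by have := Hw i Logic.I; rewrite /= eqxx.
  by have := Hw j Logic.I; rewrite /= eqxx eq_sym (negbTE ij).
move=> [Ow [h1 h2]] k _ /=.
have [->//|ki] := eqVneq k i; have [->//|kj] := eqVneq k j.
by apply: Ow; rewrite /= ki kj.
Qed.

End independence.

Section convolution.
Context {R : realType}.
Implicit Types m p q : probability R R.
Local Open Scope ereal_scope.

Let addRR (xy : R * R) : R := (xy.1 + xy.2)%R.

HB.instance Definition _ := isMeasurableFun.Build _ _ _ _ addRR (@measurable_add2 R).

Definition conv p q : probability R R := distribution (p \x q : probability (R * R)%type R) addRR.

Lemma convE p q A : conv p q A = (p \x q) ((fun xy : R * R => xy.1 + xy.2)%R @^-1` A).
Proof. by []. Qed.

Lemma conv_addge p q t : conv p q `[t, +oo[%classic = (p \x q) (addge t).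
Proof.
rewrite convE; congr ((_ \x _) _); apply/seteqP; split=> x;
  by rewrite /addge/= in_itv/= andbT.
Qed.

Lemma conv_ext p p' q q' : (forall A, measurable A -> p A = p' A) ->
  (forall A, measurable A -> q A = q' A) ->
  forall A, measurable A -> conv p q A = conv p' q' A.
Proof.
move=> Hp Hq A mA; rewrite !convE; apply: (@product_measure_unique _ _ R R R p q (p' \x q')).
  move=> B C mB mC; rewrite -[LHS]/((p' \x q') (B `*` C)) product_measure1E//.
  by congr (_ * _); [exact: esym (Hp _ mB)|exact: esym (Hq _ mC)].
by rewrite -[X in measurable X]setTI; exact: measurable_add2.
Qed.

Lemma integral_conv_expR p q (c : R) :
  \int[conv p q]_x (expR (c * x))%:E =
  \int[p]_x (expR (c * x))%:E * \int[q]_x (expR (c * x))%:E.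
Proof.
have me : measurable_fun setT (fun y : R => (expR (c * y))%:E).
  apply/measurable_EFinP; apply: (measurableT_comp (@measurable_expR R)).
  exact: mulrl_measurable.
have e0 y : 0 <= (expR (c * y))%:E by rewrite lee_fin expR_ge0.
have mce : measurable_fun setT (fun xy : R * R => (expR (c * (xy.1 + xy.2)))%:E).
  by apply: (measurableT_comp me); exact: measurable_add2.
rewrite ge0_integral_distribution//.
transitivity (\int[p]_x \int[q]_y (expR (c * (x + y)))%:E).
  by rewrite (@fubini_tonelli1 _ _ _ _ _ p q _ mce)// => xy; exact: e0.
rewrite -ge0_integralZr//; last exact: integral_ge0.
apply: eq_integral => x _; rewrite -ge0_integralZl//.
by apply: eq_integral => y _; rewrite mulrDr expRD EFinM.
Qed.

End convolution.

(** * Summing coordinates of an independent family *)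

Section merging.
Context d (T : measurableType d) (R : realType) (P : probability T R) (I : finType).
Implicit Types (X : I -> T -> R) (nu : I -> probability R R).
Local Open Scope ereal_scope.

(** Each absorbed coordinate is added to coordinate [i] and then replaced by the constant 0 with its
    Dirac law. The index type thus never changes and the merging can be iterated. *)
Lemma indep_laws_merge X nu i l : indep_laws P X nu -> uniq (i :: l) ->
  exists X' nu', [/\ indep_laws P X' nu',
    forall w, X' i w = (X i w + \sum_(k <- l) X k w)%R,
    nu' i = foldl conv (nu i) (map nu l) &
    forall k, k \notin i :: l -> X' k = X k /\ nu' k = nu k].
Proof.
elim: l X nu => [|j l IH] X nu XI; first by exists X, nu; split=> // w; rewrite big_nil addr0.
rewrite /= inE negb_or -andbA => /and4P[ij il jl ul].
pose S1 (xy : R * R) : R := (xy.1 + xy.2)%R; pose S2 (xy : R * R) : R := 0%R.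
have mS1 : measurable_fun setT S1 by exact: measurable_add2.
have mS2 : measurable_fun setT S2 by exact: measurable_cst.
have H A A' : measurable A -> measurable A' ->
    (nu i \x nu j) (S1 @^-1` A `&` S2 @^-1` A') = conv (nu i) (nu j) A * \d_(0%R : R) A'.
  move=> mA mA'; rewrite diracE.
  have [A0|A0] := boolP ((0%R : R) \in A').
    rewrite mule1 convE; congr (_ _); apply/seteqP; split=> x /=; first by case.
    by move=> ?; split=> //; rewrite inE in A0.
  rewrite mule0 (_ : _ `&` _ = set0) ?measure0// -subset0 => x [_] /=.
  by move/mem_set; rewrite (negbTE A0).
have XI' := indep_laws_pair_map XI ij mS1 mS2 H.
move: XI'; set X1 := (X in indep_laws _ X _); set nu1 := (X in indep_laws _ _ X) => XI'.
have [|X' [nu' [X'I X'i nu'i off]]] := IH _ _ XI'; first by rewrite /= il ul.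
have E k : k \in l -> X1 k = X k /\ nu1 k = nu k.
  move=> kl; rewrite /X1 /nu1.
  have -> : (k == i) = false by apply/eqP => ki; rewrite -ki kl in il.
  by have -> : (k == j) = false by apply/eqP => kj; rewrite -kj kl in jl.
exists X', nu'; split=> //.
- move=> w; rewrite X'i {1}/X1 eqxx big_cons /S1/= -addrA; congr (_ + (_ + _))%R.
  by apply: eq_big_seq => k kl; rewrite (E k kl).1.
- rewrite nu'i {1}/nu1 eqxx /=; congr (foldl _ _ _).
  by apply/eq_in_map => k kl; rewrite (E k kl).2.
- move=> k; rewrite !inE !negb_or => /and3P[ki kj kl].
  have [|-> ->] := off k; first by rewrite inE negb_or ki.
  by rewrite /X1 /nu1 (negbTE ki) (negbTE kj).
Qed.

End merging.

Section convolution_list.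
Context {R : realType}.
Implicit Types p q : probability R R.
Local Open Scope ereal_scope.

Lemma foldl_conv_ext p p' s : (forall A, measurable A -> p A = p' A) ->
  forall A, measurable A -> foldl conv p s A = foldl conv p' s A.
Proof.
elim: s p p' => [//|q s IH] p p' E A mA /=.
by apply: IH => // B mB; exact: conv_ext.
Qed.

Lemma foldl_conv_gamma_law (a b : R) n : (2^-1 <= a)%R -> (0 < b)%R ->
  forall A, measurable A ->
  foldl conv (gamma_law a b) (nseq n (gamma_law 2^-1 b)) A = gamma_law (a + n%:R / 2)%R b A.
Proof.
move=> a2 b0; elim: n a a2 => [|n IH] a a2 A mA /=; first by rewrite mul0r addr0.
have a2' : (2^-1 <= a + 2^-1)%R by rewrite lerDr (le_trans _ a2).
transitivity (foldl conv (gamma_law (a + 2^-1)%R b) (nseq n (gamma_law 2^-1 b)) A).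
  apply: foldl_conv_ext => // B mB; rewrite convE; exact: gamma_law_add.
have -> : (a + n.+1%:R / 2 = a + 2^-1 + n%:R / 2)%R by rewrite -[n.+1%:R]natr1; field.
exact: IH.
Qed.

Lemma integral_foldl_conv_expR p s (c : R) :
  \int[foldl conv p s]_x (expR (c * x))%:E =
  \int[p]_x (expR (c * x))%:E * \prod_(q <- s) \int[q]_x (expR (c * x))%:E.
Proof.
elim: s p => [|q s IH] p /=; first by rewrite big_nil mule1.
by rewrite IH integral_conv_expR big_cons muleA.
Qed.

End convolution_list.

(** * The standard normal law: weighted squares and plane rotations *)

Section standard_normal.
Context {R : realType}.
Local Notation mu := (@lebesgue_measure R).
Local Open Scope ereal_scope.

Let phi := normal_pdf 0 (1 : R).

Let mphi : measurable_fun setT phi. Proof. exact: measurable_normal_pdf. Qed.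

Let phi0 x : (0 <= phi x)%R. Proof. exact: normal_pdf_ge0. Qed.

Let phi1 : \int[mu]_x (phi x)%:E = 1. Proof. exact: integral_normal_pdf. Qed.

Definition std_normal : probability R R := density_law mphi phi0.

Lemma integral_std_normal (f : R -> \bar R) :
  measurable_fun setT f -> (forall x, 0 <= f x) ->
  \int[std_normal]_x f x = \int[mu]_x (f x * (phi x)%:E).
Proof.
by move=> mf f0; rewrite integral_density_law// phi1// ?ltry// invr1 mul1e.
Qed.

Lemma std_normalE (A : set R) : measurable A -> std_normal A = normal_prob 0 1 A.
Proof.
move=> mA; rewrite -[A in LHS]setIT -(integral_indic _ measurableT mA) integral_std_normal//.
- rewrite /normal_prob [RHS]integral_mkcond; apply: eq_integral => x _.
  by rewrite patchE indicE; case: ifP; rewrite ?mul1e ?mul0e.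
- by apply/measurable_EFinP.
Qed.

Opaque std_normal.

(** The law of [w g ^ 2] for a standard normal [g] and [w >= 0]; weight 0 gives the Dirac mass at
    0. *)
Definition chi (w : R) : probability R R :=
  if (0 < w)%R then gamma_law 2^-1 (2 * w)^-1 else \d_(0%R : R).

Lemma std_normal_sqr (w : R) (A : set R) : (0 <= w)%R -> measurable A ->
  std_normal ((fun x => w * x ^+ 2)%R @^-1` A) = chi w A.
Proof.
move=> w0 mA.
have msq : measurable_fun setT (fun x : R => (w * x ^+ 2)%R).
  by apply: measurable_funM => //; exact: measurable_funX.
have mpre : measurable ((fun x => w * x ^+ 2)%R @^-1` A).
  by rewrite -[X in measurable X]setTI; exact: msq.
rewrite /chi; case: ifPn => [w1|]; last first.
  rewrite -leNgt => w0'; have -> : w = 0%R by apply/eqP; rewrite eq_le w0 w0'.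
  rewrite -[RHS]/(\d_(0%R : R) A) diracE; have [A0|A0] := boolP ((0%R : R) \in A).
    rewrite (_ : _ @^-1` _ = setT) ?probability_setT//.
    by apply/seteqP; split=> x //= _; rewrite mul0r; rewrite inE in A0.
  rewrite (_ : _ @^-1` _ = set0) ?measure0// -subset0 => x /=.
  by rewrite mul0r => /mem_set; rewrite (negbTE A0).
pose b : R := ((2 * w)^-1)%R.
have b0 : (0 < b)%R by rewrite invr_gt0 mulr_gt0.
pose C : R := (normal_peak 1 * w `^ (- 2^-1))%R.
have E B : measurable B -> std_normal ((fun x => w * x ^+ 2)%R @^-1` B) =
    C%:E * \int[mu]_(x in B) (gw 2^-1 b x)%:E.
  move=> mB; have mpB : measurable ((fun x => w * x ^+ 2)%R @^-1` B).
    by rewrite -[X in measurable X]setTI; exact: msq.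
  have mI : measurable_fun setT (fun x : R => (\1_B x : R)%:E) by exact/measurable_EFinP.
  have I0 x : 0 <= (\1_B x : R)%:E by rewrite lee_fin.
  rewrite -[X in std_normal X]setIT -(integral_indic _ measurableT mpB) integral_std_normal//; last first.
    by apply/measurable_EFinP.
  etransitivity; first exact: (ge0_integral_gauss_sqr w1 mI I0).
  congr (_ * _); rewrite [RHS]integral_mkcond; apply: eq_integral => x _.
  by rewrite patchE indicE; case: ifP; rewrite ?mul1e ?mul0e.
have a2 : (2^-1 <= (2^-1 : R))%R by [].
(* The constant is found by applying [E] to the whole line, where both sides have mass 1. *)
have CK : C = ((fine (Kg 2^-1 b))^-1)%R.
  have := E setT measurableT; rewrite preimage_setT probability_setT.
  rewrite -/(Kg _ _) -[Kg _ _]fineK ?Kg_fin_num// -EFinM => -[] CK1.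
  have K0 : fine (Kg 2^-1 b) != 0%R.
    by apply/eqP => K0; move: CK1; rewrite K0 mulr0 => /eqP; rewrite oner_eq0.
  by rewrite -[LHS](mulfK K0) -CK1 mul1r.
by rewrite E// CK gamma_lawE.
Qed.

Let lebZl (k : \bar R) (F : R -> \bar R) : 0 <= k ->
  measurable_fun setT F -> (forall x, 0 <= F x) ->
  \int[mu]_x (k * F x) = k * \int[mu]_x F x.
Proof.
move=> k0 mF F0.
exact: (@ge0_integralZl _ (measurableTypeR R) R mu _ measurableT F mF k (fun x _ => F0 x) k0).
Qed.

Let phi_rot (c s u v : R) : (c ^+ 2 + s ^+ 2 = 1)%R ->
  (phi (s * u + c * v) * phi (c * u - s * v) = phi u * phi v)%R.
Proof.
move=> cs; rewrite /phi !normal_pdfE ?oner_eq0// /normal_fun !subr0 expr1n.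
rewrite mulrACA [RHS]mulrACA -!expRD; congr (_ * expR _)%R.
set k := (1 *+ 2)%R.
transitivity ((- (c ^+ 2 + s ^+ 2) * (u ^+ 2 + v ^+ 2)) / k)%R; first by ring.
by rewrite cs; ring.
Qed.

(* Two successive affine substitutions, one in each variable, realize the rotation. *)
Lemma std_normal_rotation (c s : R) (A A' : set R) : (c ^+ 2 + s ^+ 2 = 1)%R -> s != 0%R ->
  measurable A -> measurable A' ->
  (std_normal \x std_normal) ((fun xy : R * R => c * xy.1 + s * xy.2)%R @^-1` A `&`
    (fun xy : R * R => c * xy.2 - s * xy.1)%R @^-1` A') = std_normal A * std_normal A'.
Proof.
move=> cs s0 mA mA'.
set S := _ `&` _.
pose f u v : R := (\1_A u * \1_A' v)%R.
have f0 u v : (0 <= f u v)%R by rewrite mulr_ge0.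
have mlin (p q : R) : measurable_fun setT (fun xy : R * R => p * xy.1 + q * xy.2)%R.
  by apply: measurable_funD; apply: measurable_funM.
have mlin' (p q : R) : measurable_fun setT (fun xy : R * R => p * xy.2 - q * xy.1)%R.
  by apply: measurable_funB; apply: measurable_funM.
have mS : measurable S.
  by apply: measurableI; rewrite -[X in measurable X]setTI; [exact: mlin|exact: mlin'].
(* The integrand in the mixed coordinates [x] and [u = c x + s y]: then [y = (u - c x) / s], and
   [c ^ 2 + s ^ 2 = 1] turns [c y - s x] into [(c u - x) / s]. *)
pose G x u : R := (f u ((c * u - x) / s) * (phi ((u - c * x) / s) * phi x))%R.
have G0 x u : (0 <= G x u)%R by rewrite mulr_ge0// mulr_ge0.
have mG : measurable_fun setT (fun xu : measurableTypeR R * measurableTypeR R => (G xu.1 xu.2)%:E).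
  apply/measurable_EFinP; apply: measurable_funM.
    apply: measurable_funM.
      by apply: (measurableT_comp (measurable_indic _)).
    apply: (measurableT_comp (measurable_indic _)) => //.
    apply: measurable_funM => //; apply: measurable_funB => //.
    exact: measurable_funM.
  apply: measurable_funM; last exact: (measurableT_comp mphi).
  apply: (measurableT_comp mphi); apply: measurable_funM => //.
  by apply: measurable_funB => //; exact: measurable_funM.
have s1 : (0 <= `|s|^-1)%R by rewrite invr_ge0.
have step1 : (std_normal \x std_normal) S =
    \int[mu]_x \int[mu]_y (G x (s * y + c * x)%R)%:E.
  rewrite product_measure_integral//.
  pose J x := \int[std_normal]_y (\1_S (x, y) : R)%:E.
  have mSI : measurable_fun setT (fun xy : R * R => (\1_S xy : R)%:E).
    by apply/measurable_EFinP; exact: measurable_indic.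
  have mSx x : measurable_fun setT (fun y : R => (\1_S (x, y) : R)%:E).
    exact: (measurableT_comp mSI (measurable_pair1 x)).
  have mJ : measurable_fun setT J.
    by apply: (@measurable_fun_fubini_tonelli_F _ _ R R R std_normal _ mSI) => xy; rewrite lee_fin.
  have J0 x : 0 <= J x by apply: integral_ge0 => y _; rewrite lee_fin.
  etransitivity; first exact: (integral_std_normal mJ J0).
  apply: eq_integral => x _; rewrite /J integral_std_normal//.
  have mh : measurable_fun setT (fun y : R => (\1_S (x, y) : R)%:E * (phi y)%:E).
    by apply: emeasurable_funM => //; exact/measurable_EFinP.
  have h0 y : 0 <= (\1_S (x, y) : R)%:E * (phi y)%:E by rewrite mule_ge0// lee_fin.
  have px : 0 <= (phi x)%:E by rewrite lee_fin.
  rewrite muleC -(lebZl px mh h0).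
  apply: eq_integral => y _; rewrite -!EFinM; congr EFin.
  have -> : (\1_S (x, y) = f (c * x + s * y) (c * y - s * x) :> R)%R.
    rewrite /f !indicE -natrM mulnb; congr (_ %:R); congr nat_of_bool.
    by apply/idP/andP; rewrite /S !inE.
  rewrite /G (_ : (c * (s * y + c * x) - x) / s = c * y - s * x)%R.
    rewrite (_ : (s * y + c * x - c * x) / s = y)%R; last by field.
    by rewrite (addrC (s * y)%R); ring.
  have -> : (c * (s * y + c * x) - x = s * (c * y - s * x) + (c ^+ 2 + s ^+ 2 - 1) * x)%R by ring.
  by rewrite cs subrr mul0r addr0 mulrAC mulfV// mul1r.
have step2 x : \int[mu]_y (G x (s * y + c * x)%R)%:E = (`|s|^-1)%:E * \int[mu]_u (G x u)%:E.
  have mGx : measurable_fun setT (fun u : R => (G x u)%:E).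
    exact: (measurableT_comp mG (measurable_pair1 x)).
  by apply: (ge0_integral_affine (c * x)%R s0 mGx) => u; rewrite lee_fin.
have step3 : \int[mu]_x ((`|s|^-1)%:E * \int[mu]_u (G x u)%:E) =
   \int[mu]_u ((`|s|^-1)%:E * \int[mu]_x (G x u)%:E).
  pose h (xu : measurableTypeR R * measurableTypeR R) := (G xu.1 xu.2)%:E.
  have h0 xu : 0 <= h xu by rewrite lee_fin.
  have k0 : 0 <= (`|s|^-1)%:E by rewrite lee_fin.
  have m1 : measurable_fun setT (fun x : measurableTypeR R => \int[mu]_u h (x, u)).
    exact: (@measurable_fun_fubini_tonelli_F _ _ (measurableTypeR R) (measurableTypeR R) R mu h mG h0).
  have m2 : measurable_fun setT (fun u : measurableTypeR R => \int[mu]_x h (x, u)).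
    exact: (@measurable_fun_fubini_tonelli_G _ _ (measurableTypeR R) (measurableTypeR R) R mu h mG h0).
  have p1 x : 0 <= \int[mu]_u h (x, u) by exact: integral_ge0.
  have p2 u : 0 <= \int[mu]_x h (x, u) by exact: integral_ge0.
  transitivity ((`|s|^-1)%:E * \int[mu]_x \int[mu]_u h (x, u)); first exact: (lebZl k0 m1 p1).
  transitivity ((`|s|^-1)%:E * \int[mu]_u \int[mu]_x h (x, u)); last exact: esym (lebZl k0 m2 p2).
  have sw := @fubini_tonelli _ _ (measurableTypeR R) (measurableTypeR R) R mu mu h mG h0.
  exact: (congr1 (fun z => (`|s|^-1)%:E * z) sw).
(* At fixed [u] the second substitution is [x = c u - s v]. Its Jacobian cancels the factor left by
   the first, and the Gaussian weights recombine by [phi_rot]. *)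
have step4 u : (`|s|^-1)%:E * \int[mu]_x (G x u)%:E = \int[mu]_v (f u v * (phi u * phi v))%:E.
  have mGu : measurable_fun setT (fun x : R => (G x u)%:E).
    exact: (measurableT_comp mG (measurable_pair2 u)).
  have ns0 : (- s != 0)%R by rewrite oppr_eq0.
  have Gu0 x : 0 <= (G x u)%:E by rewrite lee_fin.
  have := ge0_integral_affine (c * u)%R ns0 mGu Gu0; rewrite normrN => <-.
  apply: eq_integral => v _; rewrite -(@phi_rot c s u v cs) /G.
  have -> : (c * u - (- s * v + c * u) = v * s)%R by ring.
  have -> : (u - c * (- s * v + c * u) = (s * u + c * v) * s)%R.
    rewrite [LHS](_ : _ = (1 - c ^+ 2) * u + c * s * v)%R; last by ring.
    by rewrite -cs; ring.
  have -> : (- s * v + c * u = c * u - s * v)%R by ring.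
  by rewrite !mulfK.
rewrite step1; under eq_integral do rewrite step2.
rewrite step3; under eq_integral do rewrite step4.
have lawI B : measurable B -> std_normal B = \int[mu]_x ((\1_B x : R) * phi x)%:E.
  move=> mB; rewrite (std_normalE mB) /normal_prob [LHS]integral_mkcond.
  apply: eq_integral => x _.
  by rewrite patchE indicE; case: ifP; rewrite ?mul1r ?mul0r.
have mI B : measurable B -> measurable_fun setT (fun x : R => ((\1_B x : R) * phi x)%:E).
  by move=> mB; apply/measurable_EFinP; apply: measurable_funM.
have I0 B x : 0 <= ((\1_B x : R) * phi x)%:E by rewrite lee_fin mulr_ge0.
transitivity (\int[mu]_u (((\1_A u : R) * phi u)%:E * std_normal A')).
  apply: eq_integral => u _; rewrite (lawI _ mA').
  etransitivity; last exact: (lebZl (I0 A u) (mI _ mA') (I0 A')).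
  by apply: eq_integral => v _; rewrite -EFinM /f mulrACA.
have N0 : 0 <= std_normal A' by exact: measure_ge0.
transitivity (\int[mu]_u (std_normal A' * ((\1_A u : R) * phi u)%:E)).
  by apply: eq_integral => u _; rewrite muleC.
etransitivity; first exact: (lebZl N0 (mI _ mA) (I0 A)).
by rewrite -(lawI _ mA) muleC.
Qed.

End standard_normal.

(** * Spectral theorem by plane rotations *)

Section symmetric_eigenvalue.
Variable R : rcfType.
Import spectral complex.
Local Open Scope complex_scope.

(** A complex eigenvalue [a] exists by algebraic closedness. For an eigenvector [u], both the
    Hermitian form of [A] at [u] and the nonzero squared norm of [u] are fixed by conjugation, so
    [a] is real; the characteristic polynomial carries it back to [R]. *)
Lemma symmetric_eigenvalue n (A : 'M[R]_n.+1) : A^T = A -> exists a, eigenvalue A a.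
Proof.
move=> sA; pose AC := map_mx (real_complex R) A.
have [a] := eigenvalue_closed AC (ltn0Sn n).
move=> ea; have /eigenvalueP[u uA u0] := ea.
pose v : 'cV[R[i]]_n.+1 := (map_mx conjc u)^T.
have N0 : (u *m v) 0 0 != 0.
  rewrite mxE; apply/negP => /eqP S0.
  have u00 i : u 0 i = 0.
    have SS : \sum_j `|u 0 j| ^+ 2 = 0.
      by under eq_bigr => j _ do rewrite sqr_normc; rewrite -[RHS]S0; under [RHS]eq_bigr => j _ do rewrite !mxE.
    have p0 j : true -> 0 <= `|u 0 j| ^+ 2 by rewrite exprn_ge0.
    have /eqP := psumr_eq0P p0 SS (erefl : xpredT i).
    by rewrite sqrf_eq0 normr_eq0 => /eqP.
  by move/eqP: u0; apply; apply/rowP => i; rewrite u00 mxE.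
have ACsym : AC^T = AC by rewrite /AC map_trmx sA.
have symA i j : AC i j = AC j i by rewrite -{1}ACsym mxE.
have conjA i j : conjc (AC i j) = AC i j by rewrite !mxE; apply/eqP; rewrite eq_complex /= oppr0 !eqxx.
have auv : (u *m AC *m v) 0 0 = a * (u *m v) 0 0 by rewrite uA -scalemxAl mxE.
have vE i : v i 0 = conjc (u 0 i) by rewrite !mxE.
have cN : conjc ((u *m v) 0 0) = (u *m v) 0 0.
  rewrite !mxE rmorph_sum; apply: eq_bigr => i _.
  by rewrite rmorphM/= vE conjcK mulrC.
have cuv : conjc ((u *m AC *m v) 0 0) = (u *m AC *m v) 0 0.
  rewrite !mxE rmorph_sum /=.
  under eq_bigr => i _ do rewrite rmorphM/= vE conjcK mxE rmorph_sum big_distrl/=.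
  under [RHS]eq_bigr => i _ do rewrite mxE big_distrl/=.
  rewrite exchange_big/=; apply: eq_bigr => i _; apply: eq_bigr => j _.
  by rewrite rmorphM/= conjA vE symA mulrC mulrA mulrAC.
have ca : conjc a = a.
  by apply: (mulIf N0); rewrite -auv -cuv auv rmorphM/= cN.
have aE : a = (complex.Re a)%:C.
  move: ca; case: a {ea uA auv} => x y /eqP; rewrite eq_complex /= => /andP[_ /eqP yy].
  by congr (_ +i* _); lra.
exists (complex.Re a); rewrite eigenvalue_root_char.
move: ea; rewrite eigenvalue_root_char aE -map_char_poly.
by rewrite fmorph_root.
Qed.

End symmetric_eigenvalue.

(** * Products of plane rotations and diagonalization *)

Section givens.
Variable R : rcfType.

Definition givens n (i j : 'I_n) (c s : R) : 'M[R]_n :=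
  \matrix_(k, l) if k == i then c * (l == i)%:R + s * (l == j)%:R
                 else if k == j then c * (l == j)%:R - s * (l == i)%:R else (k == l)%:R.

Lemma sum_pick (n : nat) (i : 'I_n) (F : 'I_n -> R) : \sum_l (l == i)%:R * F l = F i.
Proof.
rewrite (bigD1 i)//= eqxx mul1r big1 ?addr0// => l /negbTE ->.
by rewrite mul0r.
Qed.

Lemma givens_mul n p (i j : 'I_n) (c s : R) (B : 'M[R]_(n, p)) k l :
  (givens i j c s *m B) k l =
  if k == i then c * B i l + s * B j l
  else if k == j then c * B j l - s * B i l else B k l.
Proof.
rewrite mxE; under eq_bigr do rewrite mxE.
case: ifP => _; last case: ifP => _.
- under eq_bigr do rewrite mulrDl -!mulrA.
  by rewrite big_split/= -!mulr_sumr !sum_pick.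
- under eq_bigr do rewrite mulrBl -!mulrA.
  by rewrite sumrB -!mulr_sumr !sum_pick.
- by under eq_bigr do rewrite eq_sym; rewrite sum_pick.
Qed.

Lemma givens_orth n (i j : 'I_n) (c s : R) : i != j -> c ^+ 2 + s ^+ 2 = 1 ->
  (givens i j c s)^T *m givens i j c s = 1%:M.
Proof.
move=> ij cs.
have -> : (givens i j c s)^T = givens i j c (- s).
  apply/matrixP => k l; rewrite !mxE.
  have ji : (j == i) = false by rewrite eq_sym (negbTE ij).
  have [ki|ki] := eqVneq k i; [subst k|have [kj|kj] := eqVneq k j; [subst k|]];
    (have [li|li] := eqVneq l i; [subst l|have [lj|lj] := eqVneq l j; [subst l|]]);
    rewrite ?eqxx ?ji ?(negbTE ij) /=; try ring.
  - by rewrite (negbTE ki) !mulr0 addr0.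
  - by rewrite (negbTE kj) !mulr0 subr0.
  - by rewrite eq_sym.
apply/matrixP => k l; rewrite givens_mul !mxE.
have ji : (j == i) = false by rewrite eq_sym (negbTE ij).
rewrite !eqxx ji.
have [->|ki] := eqVneq k i.
  rewrite (eq_sym i l); transitivity ((c ^+ 2 + s ^+ 2) * (l == i)%:R); last by rewrite cs mul1r.
  by ring.
have [->|//] := eqVneq k j.
rewrite (eq_sym j l); transitivity ((c ^+ 2 + s ^+ 2) * (l == j)%:R); last by rewrite cs mul1r.
by ring.
Qed.

(* The spectral theorem is phrased with products of plane rotations, each with
   [s != 0], because rotation invariance of the Gaussian law is proved one plane
   at a time. *)
Inductive givens_prod n : 'M[R]_n -> Prop :=
| givens_prod1 : givens_prod 1%:M
| givens_prodM i j c s G : i != j -> c ^+ 2 + s ^+ 2 = 1 -> s != 0 ->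
    givens_prod G -> givens_prod (givens i j c s *m G).

Lemma givens_prod_orth n (G : 'M[R]_n) : givens_prod G -> G^T *m G = 1%:M.
Proof.
elim=> [|i j c s H ij cs s0 _ IH]; first by rewrite trmx1 mulmx1.
by rewrite trmx_mul -mulmxA (mulmxA _ (givens i j c s)) givens_orth// mul1mx.
Qed.

Lemma givens_prod_mul n (G H : 'M[R]_n) : givens_prod G -> givens_prod H ->
  givens_prod (G *m H).
Proof.
move=> gG gH; elim: gG => [|i j c s K ij cs s0 _ IH]; first by rewrite mul1mx.
by rewrite -mulmxA; apply: givens_prodM.
Qed.

Lemma givens_prod_lift n (G : 'M[R]_n) : givens_prod G ->
  givens_prod (block_mx 1%:M 0 0 G : 'M[R]_(1 + n)).
Proof.
elim=> [|i j c s H ij cs s0 _ IH]; first by rewrite -scalar_mx_block; exact: givens_prod1.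
have -> : block_mx 1%:M 0 0 (givens i j c s *m H) =
    block_mx 1%:M 0 0 (givens i j c s) *m block_mx 1%:M 0 0 H :> 'M[R]_(1 + n).
  by rewrite mulmx_block !(mul0mx, mulmx0, addr0, add0r, mulmx1).
have -> : block_mx 1%:M 0 0 (givens i j c s) = givens (rshift 1 i) (rshift 1 j) c s.
  apply/matrixP => k l; rewrite [in RHS]mxE.
  case: (split_ordP k) => k' ->; case: (split_ordP l) => l' ->.
  - by rewrite block_mxEul mxE !eq_lrshift (inj_eq (@lshift_inj _ _)).
  - by rewrite block_mxEur mxE !eq_lrshift.
  - rewrite block_mxEdl mxE !(inj_eq (@rshift_inj _ _)) !eq_lrshift eq_rlshift !mulr0.
    by rewrite addr0 subr0 !if_same.
  - by rewrite block_mxEdr mxE !(inj_eq (@rshift_inj _ _)).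
by apply: givens_prodM => //; rewrite (inj_eq (@rshift_inj _ _)).
Qed.

(** Each coordinate of [l] is rotated into coordinate 0. The rotation touches only these two
    coordinates, so the zeros already obtained survive. *)
Lemma givens_prod_kill n (v : 'cV[R]_n.+1) (l : seq 'I_n.+1) : uniq l -> 0 \notin l ->
  exists2 G, givens_prod G & forall i, i \in l -> (G *m v) i 0 = 0.
Proof.
elim: l => [|j l IH]; first by exists 1%:M => //; exact: givens_prod1.
rewrite inE negb_or /= => /andP[jl ul] /andP[j0 l0].
have [G gG Gv] := IH ul l0.
(* A coordinate that is already 0 is skipped: its rotation would have sine 0, which [givens_prodM]
   excludes. *)
have [wj|wj] := eqVneq ((G *m v) j 0) 0.
  by exists G => // i; rewrite inE => /orP[/eqP ->//|]; exact: Gv.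
pose a := (G *m v) 0 0; pose b := (G *m v) j 0.
have ab : 0 < a ^+ 2 + b ^+ 2 by rewrite ltr_wpDl ?sqr_ge0// exprn_even_gt0.
pose r := Num.sqrt (a ^+ 2 + b ^+ 2).
have r0 : 0 < r by rewrite sqrtr_gt0.
have r2 : r ^+ 2 = a ^+ 2 + b ^+ 2 by rewrite sqr_sqrtr// ltW.
exists (givens 0 j (a / r) (b / r) *m G).
  apply: givens_prodM => //.
    by rewrite !exprMn -mulrDl -r2 exprVn mulfV// expf_neq0// gt_eqF.
  by rewrite mulf_neq0// invr_eq0 gt_eqF.
move=> i; rewrite inE -mulmxA givens_mul => /orP[/eqP ->|il].
  by rewrite eq_sym (negbTE j0) eqxx -/a -/b; field; rewrite gt_eqF.
have -> : (i == 0) = false by apply/eqP => i0; rewrite -i0 il in l0.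
have -> : (i == j) = false by apply/eqP => i0; rewrite -i0 il in jl.
exact: Gv.
Qed.

(** Rotations carry a real eigenvector onto the first axis. By symmetry the conjugated matrix then
    splits into the eigenvalue and a smaller symmetric block, to which the induction applies. *)
Theorem givens_spectral n (A : 'M[R]_n) : A^T = A ->
  exists G, givens_prod G /\ exists d, G *m A *m G^T = diag_mx d.
Proof.
elim: n A => [|n IH] A sA.
  by exists 1%:M; split; [exact: givens_prod1|exists 0; apply/matrixP => -[]].
have [a /eigenvalueP[u uA u0]] := symmetric_eigenvalue sA.
have [|G gG Gv] := @givens_prod_kill n u^T (rem 0 (enum 'I_n.+1)) (rem_uniq _ (enum_uniq _)).
  by rewrite mem_rem_uniqF ?enum_uniq.
have GtG := givens_prod_orth gG.
have GGt : G *m G^T = 1%:M by apply: mulmx1C.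
pose B := G *m A *m G^T.
have sB : B^T = B by rewrite /B !trmx_mul trmxK sA mulmxA.
have Au : A *m u^T = a *: u^T by rewrite -{1}sA -trmx_mul uA linearZ.
pose w := G *m u^T.
have Bw : B *m w = a *: w.
  by rewrite /B /w -!mulmxA (mulmxA G^T) GtG mul1mx Au -scalemxAr.
have BG : B = G *m A *m G^T by [].
clearbody B.
have w0 i : i != 0 -> w i 0 = 0.
  by move=> i0; apply: Gv; rewrite mem_rem_uniq ?enum_uniq// inE i0 mem_enum.
have wn0 : w 0 0 != 0.
  apply: contraNneq u0 => w00; apply/eqP; apply: trmx_inj; rewrite trmx0.
  rewrite -[u^T]mul1mx -GtG -mulmxA -/w (_ : w = 0) ?mulmx0//.
  apply/colP => i; rewrite [RHS]mxE; have [->//|i0] := eqVneq i 0.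
  exact: w0.
(* Only the entry 0 of the eigenvector [w] of [B] is nonzero, so [B w = a w] determines the first
   column. *)
have Bi0 i : B i 0 = (i == 0)%:R * a.
  apply: (mulIf wn0); transitivity ((B *m w) i 0).
    rewrite [RHS]mxE (bigD1 0)//= big1 ?addr0// => k k0.
    by rewrite w0// mulr0.
  rewrite Bw [LHS]mxE; have [->|i0] := eqVneq i 0; first by rewrite mul1r.
  by rewrite (w0 _ i0) mulr0 !mul0r.
have B0i i : B 0 i = (i == 0)%:R * a by rewrite -Bi0 -[in LHS]sB [LHS]mxE.
pose B' : 'M[R]_(1 + n) := B; pose C := drsubmx B'.
have l0 : lshift n (0 : 'I_1) = 0 by apply/val_inj.
have BE : B' = block_mx a%:M 0 0 C.
  rewrite -[LHS]submxK; congr block_mx; apply/matrixP => i j; rewrite !ord1 !mxE l0.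
  - by rewrite Bi0 eqxx mul1r mulr1n.
  - by rewrite B0i mul0r.
  - by rewrite Bi0 mul0r.
have sC : C^T = C by rewrite /C trmx_drsub; congr drsubmx; exact: sB.
have [H [gH [d HC]]] := IH C sC.
pose K : 'M[R]_(1 + n) := block_mx 1%:M 0 0 H.
have main : K *m B' *m K^T = diag_mx (row_mx a%:M d).
  rewrite BE /K tr_block_mx !trmx0 trmx1 !mulmx_block.
  rewrite !(mul0mx, mulmx0, addr0, add0r, mulmx1, mul1mx) HC diag_mx_row; congr block_mx.
  by apply/matrixP => i j; rewrite !ord1 !mxE eqxx.
exists (K *m G); split.
  by apply: givens_prod_mul => //; exact: givens_prod_lift.
exists (row_mx a%:M d : 'rV[R]_(1 + n)); rewrite -main.
have -> : (K *m G)^T = G^T *m K^T by rewrite trmx_mul.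
by rewrite !mulmxA -(mulmxA K G) -(mulmxA K (G *m A)) -BG.
Qed.

End givens.

(** * Tails of Gaussian quadratic forms *)

Section rotation_invariance.
Context d (T : measurableType d) (R : realType) (P : probability T R) (m n : nat).
Implicit Types (X : 'I_m * 'I_n -> T -> R) (G : 'M[R]_n).

Let std (_ : 'I_m * 'I_n) : probability R R := std_normal.

(** Only the sample vector of index [j0] is rotated. Each factor of [G] acts on two of its
    coordinates, which is one use of [indep_laws_pair_map]. *)
Lemma indep_std_givens_block X G j0 : indep_laws P X std -> givens_prod G ->
  indep_laws P (fun ji => if ji.1 == j0 then fun w => (G *m \col_i X (j0, i) w) ji.2 0
                          else X ji) std.
Proof.
move=> XI; elim=> [|i j c s H ij cs s0 _ IH].
  suff -> : (fun ji => if ji.1 == j0 then fun w => (1%:M *m \col_i X (j0, i) w) ji.2 0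
      else X ji) = X by [].
  apply/funext => -[k l] /=; case: eqVneq => // ->; apply/funext => w.
  by rewrite mul1mx mxE.
set Y := (X in indep_laws _ X _) in IH.
pose S1 (xy : R * R) : R := c * xy.1 + s * xy.2.
pose S2 (xy : R * R) : R := c * xy.2 - s * xy.1.
have mS1 : measurable_fun setT S1.
  by apply: measurable_funD; apply: measurable_funM.
have mS2 : measurable_fun setT S2.
  by apply: measurable_funB; apply: measurable_funM.
have ijn : (j0, i) != (j0, j) by rewrite xpair_eqE eqxx.
have H12 (A A' : set R) : measurable A -> measurable A' ->
    ((std (j0, i) \x std (j0, j)) (S1 @^-1` A `&` S2 @^-1` A') =
     std_normal A * std_normal A')%E.
  by move=> mA mA'; exact: std_normal_rotation.
have := indep_laws_pair_map IH ijn mS1 mS2 H12.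
set f := (X in indep_laws _ X _ -> _); set nu := (X in indep_laws _ _ X -> _).
set g := (X in _ -> indep_laws _ X _).
have -> : nu = std by apply/funext => k; rewrite /nu; case: (k == _) => //; case: (k == _).
suff -> : f = g by [].
apply/funext => -[k l]; apply/funext => w; rewrite /f /g /Y/= !xpair_eqE eqxx.
case: (k == j0) => //=.
by rewrite -mulmxA givens_mul; case: ifP => _ //; case: ifP.
Qed.

Lemma indep_std_givens X G : indep_laws P X std -> givens_prod G ->
  indep_laws P (fun ji w => (G *m \col_i X (ji.1, i) w) ji.2 0) std.
Proof.
move=> XI gG.
pose Y (l : seq 'I_m) (ji : 'I_m * 'I_n) := if ji.1 \in l then
  fun w => (G *m \col_i X (ji.1, i) w) ji.2 0 else X ji.
have YI l : uniq l -> indep_laws P (Y l) std.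
  elim: l => [//|j0 l IH] /= /andP[j0l ul].
  have := indep_std_givens_block j0 (IH ul) gG.
  set f := (X in indep_laws _ X _ -> _) => H.
  suff <- : f = Y (j0 :: l) by [].
  apply/funext => -[k i]; rewrite /f /Y/= inE; have [->|//] := eqVneq k j0.
  apply/funext => w; rewrite (_ : \col_i0 _ = \col_i0 X (j0, i0) w)//.
  by apply/colP => i'; rewrite !mxE (negbTE j0l).
have := YI _ (enum_uniq 'I_m).
suff -> : Y (enum 'I_m) = (fun ji w => (G *m \col_i X (ji.1, i) w) ji.2 0) by [].
by apply/funext => ji; rewrite /Y mem_enum.
Qed.

Lemma iid_std_gaussian_indep (I : finType) (z : I -> {RV P >-> R}) :
  iid_std_gaussian z -> indep_laws P (fun i => z i : T -> R) (fun _ => std_normal).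
Proof.
move=> [zI zN]; split=> [i|B mB]; first exact: measurable_funP.
rewrite zI//; apply: eq_bigr => i _.
by rewrite std_normalE//; exact: (zN i _ (mB i)).
Qed.

End rotation_invariance.

Section weighted_squares.
Context d (T : measurableType d) (R : realType) (P : probability T R) (I : finType).
Local Open Scope ereal_scope.

(** The law of the sum of [x g_x ^ 2] over the weights [x] of the list, for independent standard
    normals. The head is kept apart to match the folded convolution returned by
    [indep_laws_merge]. *)
Definition csum (s : seq R) : probability R R :=
  if s is x :: s' then foldl conv (chi x) (map chi s') else \d_(0%R : R).

Lemma dirac_addge (p : probability R R) t :
  (p \x \d_(0%R : R)) (addge t) = p `[t, +oo[%classic.
Proof.
rewrite -[addge t]setIT -(integral_indic _ measurableT (measurable_addge t)).
have mI : measurable_fun setT (fun xy : R * R => (\1_(addge t) xy : R)%:E).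
  by apply/measurable_EFinP; apply: measurable_indic; exact: measurable_addge.
rewrite fubini_tonelli1//.
rewrite -[X in _ = p X]setIT -(integral_indic _ measurableT)//.
apply: eq_integral => x _; rewrite /fubini_F integral_dirac//; last first.
  exact: (measurableT_comp mI (measurable_pair1 x)).
rewrite diracT mul1e !indicE.
suff -> : ((x, 0%R) \in addge t) = (x \in `[t, +oo[%classic) by [].
by apply/idP/idP; rewrite !inE /addge/= in_itv/= andbT addr0.
Qed.

Variables (U : I -> T -> R) (w : I -> R) (w0 : R).
Hypotheses (UI : indep_laws P U (fun=> std_normal)) (w_ge0 : forall i, (0 <= w i)%R).
Hypotheses (w0_gt0 : (0 < w0)%R) (w0_ex : exists i, w i = w0).

(** The indices of weight [w0] are merged into one Gamma coordinate and the other nonzero weights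
    into a second one, then these two are added; zero weights contribute nothing to the sum. *)
Lemma weighted_squares_tail t :
  P [set x | (t <= \sum_i w i * U i x ^+ 2)%R] =
  (gamma_law (#|[pred i | w i == w0]|%:R / 2)%R (2 * w0)^-1 \x
    csum [seq w i | i <- enum I & (w i != w0) && (w i != 0%R)]) (addge t).
Proof.
have XI : indep_laws P (fun i => (fun x => w i * x ^+ 2)%R \o U i) (fun i => chi (w i)).
  apply: indep_laws_comp UI.
    by move=> i; apply: measurable_funM => //; exact: measurable_funX.
  by move=> i A mA; exact: std_normal_sqr.
set XX := (X in indep_laws _ X _) in XI.
rewrite (_ : [seq w i | i <- enum I & _] = map w [seq i <- enum I | (w i != w0) && (w i != 0%R)])//.
set lr := [seq i <- enum I | _].
pose lt := [seq i <- enum I | w i == w0].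
have ult : uniq lt by rewrite filter_uniq// enum_uniq.
have ulr : uniq lr by rewrite filter_uniq// enum_uniq.
have card_lt : #|[pred i | w i == w0]| = size lt.
  by rewrite cardE /enum_mem -enumT; congr size; apply: eq_filter => i; rewrite !inE.
have sumE x : (\sum_i w i * U i x ^+ 2 = \sum_(i <- lt) XX i x + \sum_(i <- lr) XX i x)%R.
  rewrite !big_filter !big_enum_cond /= (bigID (fun i => w i == w0))/=; congr (_ + _)%R.
  rewrite (bigID (fun i => w i == 0%R))/= big1 ?add0r//.
  by move=> i /andP[_ /eqP ->]; rewrite mul0r.
have disj k : k \in lr -> k \notin lt.
  by rewrite !mem_filter => /andP[/andP[/negbTE -> _] _].
have ltw k : k \in lt -> w k = w0 by rewrite mem_filter => /andP[/eqP].
rewrite card_lt; move: sumE disj ltw ult.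
case E : lt => [|i0 l0] sumE disj ltw ult.
  have [i wi] := w0_ex; have : i \in lt by rewrite mem_filter wi eqxx mem_enum.
  by rewrite E.
have [X1 [nu1 [X1I X1i0 nu1i0 off1]]] := indep_laws_merge XI ult.
have w0' : (0 < (2 * w0)^-1)%R by rewrite invr_gt0 mulr_gt0.
have topE A : measurable A -> nu1 i0 A = gamma_law ((size (i0 :: l0))%:R / 2)%R (2 * w0)^-1 A.
  move=> mA; rewrite nu1i0.
  have chi0 : chi w0 = gamma_law 2^-1 (2 * w0)^-1 by rewrite /chi w0_gt0.
  have -> : [seq chi (w i) | i <- l0] = nseq (size l0) (gamma_law 2^-1 (2 * w0)^-1).
    have mapc (g : probability R R) (l : seq I) : [seq g | _ <- l] = nseq (size l) g.
      by elim: l => //= _ l ->.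
    rewrite -mapc; apply/eq_in_map => k kl.
    by rewrite ltw ?chi0// inE kl orbT.
  rewrite (ltw i0) ?mem_head// chi0.
  have -> : ((size (i0 :: l0))%:R / 2 = 2^-1 + (size l0)%:R / 2 :> R)%R.
    by rewrite /= -natr1; field.
  exact: foldl_conv_gamma_law.
case Er : lr => [|j0 r0].
  rewrite dirac_addge -topE// -(indep_laws_law i0 X1I)//.
  congr (P _); apply/seteqP; split=> x /=; rewrite in_itv/= andbT sumE Er big_nil addr0;
    by rewrite X1i0 big_cons.
rewrite Er in disj ulr.
have [X2 [nu2 [X2I X2j0 nu2j0 off2]]] := indep_laws_merge X1I ulr.
have i0r : i0 \notin j0 :: r0.
  by apply/negP => /disj; rewrite mem_head.
have offr k : k \in j0 :: r0 -> X1 k = XX k /\ nu1 k = chi (w k).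
  by move=> /disj; exact: off1.
have nu2E : nu2 j0 = csum (map w (j0 :: r0)).
  rewrite nu2j0 /= -map_comp (offr j0 (mem_head _ _)).2; congr (foldl conv _ _).
  by apply/eq_in_map => k kr; rewrite (offr k _).2// inE kr orbT.
have u2 : uniq [:: i0; j0].
  by rewrite /= inE andbT; apply: contra i0r => /eqP ->; exact: mem_head.
have [X3 [nu3 [X3I X3i0 nu3i0 _]]] := indep_laws_merge X2I u2.
have [X2i0 nu2i0] := off2 i0 i0r.
have SE x : (\sum_i w i * U i x ^+ 2 = X3 i0 x)%R.
  rewrite sumE Er X3i0 big_seq1 X2i0 X2j0 X1i0 !big_cons (offr j0 (mem_head _ _)).1.
  congr (_ + (_ + _))%R; apply: eq_big_seq => k kr.
  by rewrite (offr k _).1// inE kr orbT.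
have -> : [set x | (t <= \sum_i w i * U i x ^+ 2)%R] = X3 i0 @^-1` `[t, +oo[%classic.
  by apply/seteqP; split=> x /=; rewrite in_itv/= andbT SE.
rewrite (indep_laws_law i0 X3I)// nu3i0 /= nu2E nu2i0 -conv_addge.
exact: conv_ext.
Qed.

End weighted_squares.

(** * Eventual comparison of tails *)

Section tail_comparison.
Context {R : realType}.
Implicit Types (a b c t : R) (s : seq R).

(* [E exp (c x g^2)] for a standard normal [g]. *)
Definition sqrt_geom c x : R := ((1 - 2 * c * x)^-1) `^ 2^-1.

Definition chi_mgf c s : R := \prod_(x <- s) sqrt_geom c x.

Lemma integral_expR_chi c x : 0 < x -> 2 * c * x < 1 ->
  (\int[chi x]_y (expR (c * y))%:E = (sqrt_geom c x)%:E)%E.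
Proof.
move=> x0 cx; rewrite /chi x0 integral_expR_gamma_law//.
- congr (_ `^ _)%:E; field.
  by rewrite !gt_eqF//; lra.
- by rewrite invr_gt0 mulr_gt0.
- by rewrite -[ltRHS]mul1r ltr_pdivlMr ?mulr_gt0//; lra.
Qed.

Lemma integral_expR_csum c s : (forall x, x \in s -> 0 < x /\ 2 * c * x < 1) ->
  (\int[csum s]_y (expR (c * y))%:E = (chi_mgf c s)%:E)%E.
Proof.
have me : measurable_fun setT (fun y : R => (expR (c * y))%:E).
  apply/measurable_EFinP; apply: (measurableT_comp (@measurable_expR R)).
  exact: mulrl_measurable.
case: s => [_|x s H].
  by rewrite /csum /chi_mgf big_nil integral_dirac// diracT mul1e mulr0 expR0.
rewrite /csum integral_foldl_conv_expR big_map /chi_mgf big_cons EFinM.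
have [x0 cx] := H x (mem_head _ _).
apply: (f_equal2 mule); first exact: integral_expR_chi.
rewrite -prodEFin; apply: eq_big_seq => y ys.
have [|y0 cy] := H y; first by rewrite inE ys orbT.
exact: integral_expR_chi.
Qed.

Lemma chi_mgf_gt0 c s : (forall x, x \in s -> 2 * c * x < 1) -> 0 < chi_mgf c s.
Proof.
move=> H; rewrite /chi_mgf big_seq; apply: prodr_gt0 => x xs.
by rewrite powR_gt0// invr_gt0 subr_gt0 H.
Qed.

(** Finitely many strict inequalities leave room above [b]. The rate found is the one at which the
    dominating function is integrable. *)
Lemma exists_larger_rate b s : 0 < b -> (forall x, x \in s -> 0 < x /\ 2 * b * x < 1) ->
  exists2 c, b < c & forall x, x \in s -> 0 < x /\ 2 * c * x < 1.
Proof.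
move=> b0; elim: s => [_|y s IH H]; first by exists (b + 1); rewrite ?ltrDl.
have [|c bc Hc] := IH; first by move=> x xs; apply: H; rewrite inE xs orbT.
have [y0 by1] := H y (mem_head _ _).
have yb : b < (2 * y)^-1 by rewrite -[ltRHS]mul1r ltr_pdivlMr ?mulr_gt0//; lra.
exists (Num.min c ((b + (2 * y)^-1) / 2)).
  by rewrite lt_min bc/=; lra.
move=> x; rewrite inE => /orP[/eqP ->|xs].
  split=> //; have : Num.min c ((b + (2 * y)^-1) / 2) < (2 * y)^-1.
    by rewrite gt_min; apply/orP; right; lra.
  by rewrite -[ltRHS]mul1r ltr_pdivlMr ?mulr_gt0//; lra.
have [x0 cx] := Hc x xs; split=> //; apply: le_lt_trans cx.
by rewrite ler_pM2r// ler_pM2l// ge_min lexx.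
Qed.

(* Since [addge t] is the event [t <= X + Y], this is the upper tail of a Gamma
   variable plus an independent weighted sum of squared normals. *)
Definition Ftail a b s t : \bar R := ((gamma_law a b \x csum s) (addge t))%E.

Lemma Ftail_cvg a b s (u : nat -> R) : 2^-1 <= a -> 0 < b ->
  (forall x, x \in s -> 0 < x /\ 2 * b * x < 1) ->
  (forall n, 1 <= u n) -> u @ \oo --> +oo ->
  ((fine (Kg a b) / wtail a b (u n))%:E * Ftail a b s (u n))%E @[n --> \oo]
    --> (chi_mgf b s)%:E.
Proof.
move=> a2 b0 Hs u1 uoo.
have [c bc Hc] := exists_larger_rate b0 Hs.
rewrite -integral_expR_csum//.
apply: (@convolution_tail_cvg R a b c (csum s) a2 b0 bc) => //.
by rewrite integral_expR_csum// ltry.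
Qed.

(* Otherwise the reverse inequality holds along a sequence tending to infinity,
   where the limits of Ftail_cvg contradict it. *)
Lemma Ftail_eventually_le a a' b s s' (T0 k : R) : 2^-1 <= a -> 2^-1 <= a' -> 0 < b ->
  (forall x, x \in s -> 0 < x /\ 2 * b * x < 1) ->
  (forall x, x \in s' -> 0 < x /\ 2 * b * x < 1) ->
  0 <= k ->
  (forall t, T0 <= t -> fine (Kg a' b) / wtail a' b t <= k * (fine (Kg a b) / wtail a b t)) ->
  k * chi_mgf b s < chi_mgf b s' ->
  exists t0, forall t, t0 <= t -> (Ftail a b s t <= Ftail a' b s' t)%E.
Proof.
move=> a2 a2' b0 Hs Hs' k0 Hk kM; apply: contrapT => /forallNP H.
have {}H t0 : exists t, t0 <= t /\ (Ftail a' b s' t < Ftail a b s t)%E.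
  have /existsNP[t /not_implyP[tt /negP]] := H t0.
  by rewrite -ltNge => lt; exists t.
(* The bound [n + 1] keeps the sequence above 1 and sends it to infinity, while [T0] brings it into
   the range of [Hk]. *)
have /choice[u Hu] : forall n : nat, exists t, Num.max T0 n.+1%:R <= t /\
  (Ftail a' b s' t < Ftail a b s t)%E by move=> n; exact: H.
have u1 n : 1 <= u n.
  have [+ _] := Hu n; rewrite ge_max => /andP[_]; apply: le_trans.
  by rewrite ler1n.
have uT n : T0 <= u n by have [+ _] := Hu n; rewrite ge_max => /andP[].
have uoo : u @ \oo --> +oo.
  apply/cvgryPge => A; near=> n.
  have [+ _] := Hu n; rewrite ge_max => /andP[_]; apply: le_trans.
  rewrite (@le_trans _ _ n%:R)// ?ler_nat//; near: n; exact: nbhs_infty_ger.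
have c1 := Ftail_cvg a2 b0 Hs u1 uoo.
have c2 := Ftail_cvg a2' b0 Hs' u1 uoo.
have c3 : (k%:E * ((fine (Kg a b) / wtail a b (u n))%:E * Ftail a b s (u n)))%E @[n --> \oo]
    --> (k%:E * (chi_mgf b s)%:E)%E by apply: cvgeZl.
suff : ((chi_mgf b s')%:E <= k%:E * (chi_mgf b s)%:E)%E.
  by rewrite -EFinM lee_fin leNgt kM.
apply: (lee_cvg_to c2 c3); near=> n; have [_ lt] := Hu n.
rewrite muleA -EFinM.
have r0 : 0 <= fine (Kg a' b) / wtail a' b (u n).
  rewrite divr_ge0 ?(ltW (wtail_gt0 _ a2' b0))// fine_ge0// ltW// Kg_gt0 ?(ltW b0)//.
  by rewrite (le_trans _ a2').
apply: (@le_trans _ _ ((fine (Kg a' b) / wtail a' b (u n))%:E * Ftail a b s (u n))%E).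
  by apply: lee_wpmul2l; [rewrite lee_fin|exact: ltW lt].
apply: lee_wpmul2r; first exact: measure_ge0.
by rewrite lee_fin; exact: Hk.
Unshelve. all: by end_near.
Qed.

End tail_comparison.

Section tail_comparison_cases.
Context {R : realType}.
Implicit Types (a b c t : R) (s : seq R).

Let good b s := forall x, x \in s -> 0 < x /\ 2 * b * x < 1.

Let div_tail_le (x Z k K K' w w' : R) : Z <= x -> x * w <= w' -> 0 < k * K ->
  K' = Z * (k * K) -> 0 < w -> 0 < w' -> K' / w' <= k * (K / w).
Proof.
move=> Zx xw kK -> w0 w0'.
rewrite ler_pdivrMr// (_ : k * (K / w) * w' = k * K * w' / w); last by ring.
rewrite ler_pdivlMr// (_ : Z * (k * K) * w = k * K * (Z * w)); last by ring.
rewrite ler_wpM2l ?(ltW kK)//.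
by apply: le_trans xw; rewrite ler_wpM2r// ltW.
Qed.

Lemma Ftail_lt_exponent a a' b s s' : 2^-1 <= a -> a < a' -> 0 < b ->
  good b s -> good b s' ->
  exists t0, forall t, t0 <= t -> (Ftail a b s t <= Ftail a' b s' t)%E.
Proof.
move=> a2 aa b0 Hs Hs'; have a2' : 2^-1 <= a' by rewrite (le_trans a2)// ltW.
have M0 : 0 < chi_mgf b s by apply: chi_mgf_gt0 => x /Hs[].
have M0' : 0 < chi_mgf b s' by apply: chi_mgf_gt0 => x /Hs'[].
have K0 c : 2^-1 <= c -> 0 < fine (Kg c b).
  move=> c2; rewrite fine_gt0// Kg_fin// Kg_gt0 ?(ltW b0)//.
  by rewrite (le_trans _ c2).
(* Any constant below the quotient of the moments would do; half of it makes [k * chi_mgf b s] equal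
   to half of [chi_mgf b s']. *)
pose k := chi_mgf b s' / (2 * chi_mgf b s).
have k0 : 0 < k by rewrite divr_gt0// mulr_gt0.
have kK : 0 < k * fine (Kg a b) by apply: mulr_gt0 => //; exact: K0.
pose Z := fine (Kg a' b) / (k * fine (Kg a b)).
have Z0 : 0 < Z by apply: divr_gt0 => //; exact: K0.
have d0 : 0 < a' - a by rewrite subr_gt0.
(* From this point on [t ^ (a' - a)] exceeds [Z], which is what the normalizing constants cost. *)
apply: (@Ftail_eventually_le _ a a' b s s' (Z `^ (a' - a)^-1) k) => //.
- exact: ltW.
- move=> t tZ.
  have t0 : 0 < t by rewrite (lt_le_trans _ tZ)// powR_gt0.
  have tp : Z <= t `^ (a' - a).
    have -> : Z = (Z `^ (a' - a)^-1) `^ (a' - a).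
      by rewrite -powRrM mulVf ?gt_eqF// powRr1// ltW.
    by rewrite ge0_ler_powR ?nnegrE ?powR_ge0 ?(ltW t0) ?(ltW d0).
  have W := wtail_exponent a2 (ltW aa) b0 t0.
  have w0 := wtail_gt0 t a2 b0; have w0' := wtail_gt0 t a2' b0.
  by apply: (div_tail_le tp W kK _ w0 w0'); rewrite /Z divfK// gt_eqF.
- rewrite /k; have -> : chi_mgf b s' / (2 * chi_mgf b s) * chi_mgf b s = chi_mgf b s' / 2.
    by field; rewrite gt_eqF.
  by lra.
Qed.

Lemma Ftail_same_exponent a b s s' : 2^-1 <= a -> 0 < b -> good b s -> good b s' ->
  chi_mgf b s < chi_mgf b s' ->
  exists t0, forall t, t0 <= t -> (Ftail a b s t <= Ftail a b s' t)%E.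
Proof.
move=> a2 b0 Hs Hs' M.
apply: (@Ftail_eventually_le _ a a b s s' 0 1) => //; last by rewrite mul1r.
by move=> t _; rewrite mul1r.
Qed.

End tail_comparison_cases.

(** * The trace estimator as a weighted sum of squares *)

Section quadratic_form.
Context d (T : measurableType d) (R : realType) (P : probability T R) (m n : nat).
Variables (M G : 'M[R]_n) (dg : 'rV[R]_n) (tau D eps : R) (z : 'I_m * 'I_n -> {RV P >-> R}).
Hypotheses (gG : givens_prod G) (GM : G *m M *m G^T = diag_mx dg).
Hypotheses (dg_ge0 : forall i, 0 <= dg 0 i) (tau_gt0 : 0 < tau) (m_gt0 : (0 < m)%N).
Hypotheses (D_gt0 : 0 < D) (D_ex : exists i, dg 0 i = D) (eps_gt1 : 1 < eps).
Hypothesis zG : iid_std_gaussian z.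

Let wt (ji : 'I_m * 'I_n) : R := dg 0 ji.2 / (m%:R * tau).

Let mt_gt0 : 0 < m%:R * tau. Proof. by rewrite mulr_gt0// ltr0n. Qed.

Let U (ji : 'I_m * 'I_n) (w : T) : R := (G *m \col_i z (ji.1, i) w) ji.2 0.

Let form_diag (v : 'cV[R]_n) : (v^T *m M *m v) 0 0 = \sum_i dg 0 i * (G *m v) i 0 ^+ 2.
Proof.
have GtG := givens_prod_orth gG.
have -> : M = G^T *m diag_mx dg *m G.
  by rewrite -GM !mulmxA GtG mul1mx -mulmxA GtG mulmx1.
have -> : v^T *m (G^T *m diag_mx dg *m G) *m v = (G *m v)^T *m (diag_mx dg *m (G *m v)).
  by rewrite trmx_mul !mulmxA.
rewrite mxE; apply: eq_bigr => i _; rewrite mul_diag_mx [_^T _ _]mxE [(\matrix_(_, _) _) _ _]mxE.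
by rewrite expr2 mulrCA.
Qed.

Let trGE w : trG M (sample_vec z w) / tau = \sum_ji wt ji * U ji w ^+ 2.
Proof.
rewrite /trG mulrAC mulr_sumr.
rewrite (eq_bigr (fun ji => wt (ji.1, ji.2) * U (ji.1, ji.2) w ^+ 2)); last by case.
rewrite -(pair_bigA _ (fun j i => wt (j, i) * U (j, i) w ^+ 2))/=.
apply: eq_bigr => j _; rewrite form_diag mulr_sumr; apply: eq_bigr => i _.
by rewrite /wt /U /sample_vec/= invfM mulrCA mulrA.
Qed.

(* Zero weights are dropped so that the list obtained for [A_rel mu k] does not
   depend on [k], in which the threshold has to be uniform. *)
Definition form_weights : seq R :=
  [seq dg 0 ji.2 / (m%:R * tau) | ji <- enum {: 'I_m * 'I_n} &
    (dg 0 ji.2 != D) && (dg 0 ji.2 != 0)].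

Lemma quadratic_form_tail :
  P [set w | eps * tau <= `| trG M (sample_vec z w) - tau |] =
  Ftail ((m * #|[pred i | dg 0 i == D]|)%:R / 2) (m%:R * tau / (2 * D)) form_weights (1 + eps).
Proof.
have UI := indep_std_givens (iid_std_gaussian_indep zG) gG.
have wt_ge0 ji : 0 <= wt ji by apply: divr_ge0 => //; exact: ltW.
have -> : [set w | eps * tau <= `| trG M (sample_vec z w) - tau |] =
   [set w | 1 + eps <= \sum_ji wt ji * U ji w ^+ 2].
  apply/seteqP; suff E w : (eps * tau <= `| trG M (sample_vec z w) - tau |) =
      (1 + eps <= \sum_ji wt ji * U ji w ^+ 2) by split=> w /=; rewrite E.
  set q := \sum_ji _.
  have q0 : 0 <= q by apply: sumr_ge0 => ji _; rewrite mulr_ge0// sqr_ge0.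
  have -> : trG M (sample_vec z w) = q * tau by rewrite /q -trGE divfK// gt_eqF.
  rewrite -[X in _ - X]mul1r -mulrBl normrM (gtr0_norm tau_gt0) ler_pM2r//.
  (* The lower deviation would require [q <= 1 - eps < 0], against [q0]. *)
  have e1 := eps_gt1; rewrite ler_normr.
  by apply/orP/idP => [[h|h]|h]; [lra|lra|left; lra].
pose w0 := D / (m%:R * tau).
have wt_eq c ji : (wt ji == c / (m%:R * tau)) = (dg 0 ji.2 == c).
  by rewrite /wt (inj_eq (mulIf _))// invr_eq0 gt_eqF.
have w0_gt0 : 0 < w0 by rewrite divr_gt0.
have w0_ex : exists ji, wt ji = w0.
  have [i Di] := D_ex; exists (Ordinal m_gt0, i).
  by apply/eqP; rewrite wt_eq Di.
have E1 : (2 * w0)^-1 = m%:R * tau / (2 * D).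
  by rewrite /w0; field; rewrite !gt_eqF// ltr0n.
have E2 : #|[pred i | wt i == w0]| = (m * #|[pred i | dg 0%R i == D]|)%N.
  rewrite -[m in RHS]card_ord -cardX; apply: eq_card => ji.
  by rewrite !inE/= wt_eq.
have E3 : [seq wt i | i <- enum {: 'I_m * 'I_n} & (wt i != w0) && (wt i != 0)] = form_weights.
  rewrite /form_weights; congr map; apply: eq_filter => ji; rewrite wt_eq.
  by have := wt_eq 0 ji; rewrite mul0r => ->.
by have := weighted_squares_tail UI wt_ge0 w0_gt0 w0_ex (1 + eps); rewrite E1 E2 E3.
Qed.

End quadratic_form.

(** * Comparison of the tails *)

Section weights.
Context {R : realType}.
Implicit Types (r : seq R) (x y c : R).

Lemma form_weights_nseq m n (dg : 'rV[R]_n) (tau D y : R) :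
  (forall i, dg 0 i != D -> dg 0 i != 0 -> dg 0 i = y) ->
  form_weights m dg tau D =
  nseq (m * #|[pred i | ((dg 0 i != D) && (dg 0 i != 0))%R]|)%N (y / (m%:R * tau)).
Proof.
move=> H; rewrite /form_weights.
have -> : (m * #|[pred i | ((dg 0 i != D) && (dg 0 i != 0))%R]|)%N =
    size [seq ji <- enum {: 'I_m * 'I_n} | (dg 0 ji.2 != D) && (dg 0 ji.2 != 0)].
  rewrite -[m in LHS]card_ord -cardX -sum1_card size_filter -sum1_count big_enum_cond.
  by apply: eq_bigl => ji; rewrite !inE.
have key (l : seq ('I_m * 'I_n)) : all (fun ji => (dg 0 ji.2 != D) && (dg 0 ji.2 != 0)) l ->
    [seq dg 0 ji.2 / (m%:R * tau) | ji <- l] = nseq (size l) (y / (m%:R * tau)).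
  by elim: l => //= ji l IH /andP[/andP[h1 h2] /IH ->]; rewrite (H _ h1 h2).
by apply: key; exact: filter_all.
Qed.

Lemma chi_mgf_nseq c m y : chi_mgf c (nseq m y) = sqrt_geom c y ^+ m.
Proof.
by elim: m => [|m IH]; rewrite /chi_mgf ?big_nil//= big_cons -/(chi_mgf _ _) IH exprS.
Qed.

Lemma chi_mgf_form_weights c m n (dg : 'rV[R]_n) (tau D : R) :
  chi_mgf c (form_weights m dg tau D) =
  (\prod_(i | (dg 0 i != D) && (dg 0 i != 0)) sqrt_geom c (dg 0 i / (m%:R * tau))) ^+ m.
Proof.
rewrite /chi_mgf big_map big_filter big_enum_cond/=.
rewrite -(pair_big_dep xpredT (fun _ i => (dg 0 i != D) && (dg 0 i != 0))
  (fun _ i => sqrt_geom c (dg 0 i / (m%:R * tau))))/=.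
by rewrite prodr_const card_ord.
Qed.

Let in01 r := forall y, y \in r -> 0 < y < 1.

(** The Weierstrass product inequality; the bounds on the product are carried along for its
    induction. *)
Lemma prod_onem_ge r : in01 r ->
  [/\ 0 < \prod_(y <- r) (1 - y), \prod_(y <- r) (1 - y) <= 1 &
      1 - \sum_(y <- r) y <= \prod_(y <- r) (1 - y)].
Proof.
elim: r => [|x r IH] H; first by rewrite !big_nil subr0.
have [|p0 p1 ps] := IH; first by move=> y yr; apply: H; rewrite inE yr orbT.
have /andP[x0 x1] := H x (mem_head _ _).
by rewrite !big_cons; split; nra.
Qed.

(** The strict gain is the cross term [x * z * Q] of the first two factors. *)
Lemma prod_onem_gt r : in01 r -> (1 < size r)%N ->
  1 - \sum_(y <- r) y < \prod_(y <- r) (1 - y).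
Proof.
case: r => [//|x [//|z r]] H _.
have [|p0 p1 ps] := @prod_onem_ge r.
  by move=> y yr; apply: H; rewrite !inE yr !orbT.
have /andP[x0 x1] : 0 < x < 1 by apply: H; rewrite inE eqxx.
have /andP[z0 z1] : 0 < z < 1 by apply: H; rewrite !inE eqxx orbT.
rewrite !big_cons.
set S := \sum_(_ <- _) _ in ps *; set Q := \prod_(_ <- _) _ in p0 p1 ps *.
have h1 : 0 < x * z * Q by rewrite !mulr_gt0.
have h2 : 0 <= x * (1 - Q) by rewrite mulr_ge0 ?subr_ge0// ltW.
have h3 : 0 <= z * (1 - Q) by rewrite mulr_ge0 ?subr_ge0// ltW.
have -> : (1 - x) * ((1 - z) * Q) = Q - x - z + x * (1 - Q) + z * (1 - Q) + x * z * Q by ring.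
by lra.
Qed.

Lemma prod_sqrt_geom (I : Type) (l : seq I) (P : pred I) (F : I -> R) (c : R) :
  (forall i, P i -> 2 * c * F i < 1) ->
  \prod_(i <- l | P i) sqrt_geom c (F i) =
  ((\prod_(i <- l | P i) (1 - 2 * c * F i))^-1) `^ 2^-1.
Proof.
move=> H.
suff [-> _] : \prod_(i <- l | P i) sqrt_geom c (F i) =
  ((\prod_(i <- l | P i) (1 - 2 * c * F i))^-1) `^ 2^-1 /\
  0 < \prod_(i <- l | P i) (1 - 2 * c * F i) by [].
elim: l => [|i l [IH1 IH2]]; first by rewrite !big_nil invr1 powR1.
rewrite !big_cons; case: ifP => // Pi.
have Fi : 0 < 1 - 2 * c * F i by rewrite subr_gt0 H.
split; last exact: mulr_gt0.
by rewrite IH1 /sqrt_geom -powRM ?invr_ge0 ?(ltW Fi) ?(ltW IH2)// invfM.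
Qed.

End weights.

Section spectral_norm.
Variables (R : realType) (n : nat) (A G : 'M[R]_n) (dg : 'rV[R]_n).
Hypotheses (gG : givens_prod G) (GA : G *m A *m G^T = diag_mx dg).

Let GtG : G^T *m G = 1%:M. Proof. exact: givens_prod_orth. Qed.

Let GGt : G *m G^T = 1%:M. Proof. exact: mulmx1C. Qed.

Let AE : A = G^T *m diag_mx dg *m G.
Proof. by rewrite -GA !mulmxA GtG mul1mx -mulmxA GtG mulmx1. Qed.

Lemma trace_givens : \tr A = \sum_i dg 0 i.
Proof. by rewrite AE mxtrace_mulC mulmxA GGt mul1mx mxtrace_diag. Qed.

Lemma givens_psd i : (forall v : 'cV[R]_n, 0 <= (v^T *m A *m v) 0 0) -> 0 <= dg 0 i.
Proof.
move=> /(_ (G^T *m delta_mx i 0)).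
rewrite trmx_mul trmxK -!mulmxA (mulmxA A) (mulmxA G) (mulmxA G) GA.
by rewrite trmx_delta mul_diag_mx -rowE !mxE eqxx mulr1.
Qed.

Let vnorm_sqr (v : 'cV[R]_n) : vnorm v ^+ 2 = (v^T *m v) 0 0.
Proof.
rewrite /vnorm sqr_sqrtr ?sumr_ge0// => [|i _]; last exact: sqr_ge0.
by rewrite mxE; apply: eq_bigr => i _; rewrite mxE expr2.
Qed.

(** An orthogonal change of coordinates preserves [vnorm], so the supremum is that of a diagonal
    matrix; it is attained at the rotated basis vector of index [i0]. *)
Lemma spec_norm_givens i0 : (forall i, 0 <= dg 0 i) -> (forall i, dg 0 i <= dg 0 i0) ->
  spec_norm A = dg 0 i0.
Proof.
move=> d0 dmax.
have nG v : vnorm (G^T *m v) = vnorm v.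
  apply/eqP; rewrite -(@eqrXn2 _ 2)// ?sqrtr_ge0// !vnorm_sqr.
  by rewrite trmx_mul trmxK mulmxA -(mulmxA v^T) GGt mulmx1.
have nG' v : vnorm (G *m v) = vnorm v.
  by rewrite -nG mulmxA GtG mul1mx.
have ub v : vnorm v = 1 -> vnorm (A *m v) <= dg 0 i0.
  move=> v1; rewrite AE -!mulmxA nG.
  rewrite -(@ler_pXn2r _ 2) ?nnegrE ?sqrtr_ge0// vnorm_sqr.
  have -> : dg 0 i0 ^+ 2 = dg 0 i0 ^+ 2 * vnorm (G *m v) ^+ 2 by rewrite nG' v1 expr1n mulr1.
  rewrite vnorm_sqr !mxE mulr_sumr; apply: ler_sum => i _.
  rewrite mul_diag_mx [_^T _ _]mxE [(\matrix_(_, _) _) _ _]mxE [(_^T) 0 i]mxE.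
  set u := (G *m v) i 0.
  by rewrite mulrACA -!expr2 ler_wpM2r ?sqr_ge0// ler_pXn2r// nnegrE.
pose e := G^T *m delta_mx i0 0 : 'cV[R]_n.
have e1 : vnorm e = 1.
  apply/eqP; rewrite nG -(@eqrXn2 _ 2)// ?sqrtr_ge0// vnorm_sqr expr1n.
  by rewrite trmx_delta mul_delta_mx !mxE !eqxx.
have Ae : A *m e = dg 0 i0 *: e.
  rewrite AE /e -!mulmxA (mulmxA G) GGt mul1mx scalemxAr; congr (_ *m _).
  rewrite mul_diag_mx; apply/colP => i; rewrite !mxE.
  by have [->//|] := eqVneq i i0; rewrite !mulr0.
have nAe : vnorm (A *m e) = dg 0 i0.
  rewrite Ae; apply/eqP; rewrite -(@eqrXn2 _ 2)// ?sqrtr_ge0// vnorm_sqr.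
  have -> : (dg 0 i0 *: e)^T = dg 0 i0 *: e^T by apply/matrixP => i j; rewrite [LHS]mxE [LHS]mxE [RHS]mxE [in RHS]mxE.
  rewrite -scalemxAl -scalemxAr scalerA mxE -vnorm_sqr e1 expr1n mulr1.
  by rewrite expr2.
apply/eqP; rewrite eq_le; apply/andP; split.
- apply: ge_sup; first by exists (dg 0 i0), e.
  by move=> _ [v v1 <-]; exact: ub.
- apply: ub_le_sup; last by exists e.
  by exists (dg 0 i0) => _ [v v1 <-]; exact: ub.
Qed.

End spectral_norm.

(** * Spectrum of the comparison matrix *)

Section relaxed_matrix.
Variables (R : realType) (mu : R) (k : nat).
Hypothesis mu1 : 1 <= mu.

Local Notation q := (Num.truncn mu).
Let r : R := mu - q%:R.

Definition rel_diag : 'rV[R]_(q + (1 + k)) :=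
  mu^-1 *: row_mx (const_mx 1) (row_mx (const_mx r) 0).

Let mu0 : 0 < mu. Proof. by rewrite (lt_le_trans ltr01). Qed.

Let qmu : q%:R <= mu < q.+1%:R. Proof. by rewrite truncn_itv// ltW. Qed.

Let r01 : 0 <= r < 1.
Proof.
by have /andP[h1] := qmu; rewrite /r -natr1 => h2; apply/andP; split; lra.
Qed.

Lemma A_rel_diag : A_rel mu k = diag_mx rel_diag.
Proof.
rewrite /A_rel /rel_diag linearZ/=; congr (_ *: _).
rewrite !diag_mx_row !diag_const_mx; congr block_mx; congr block_mx.
by apply/matrixP => i j; rewrite !mxE mul0rn.
Qed.

Let rel_l i : rel_diag 0 (lshift (1 + k) i) = mu^-1.
Proof. by rewrite mxE row_mxEl mxE mulr1. Qed.

Let rel_m i : rel_diag 0 (rshift q (lshift k i)) = mu^-1 * r.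
Proof. by rewrite mxE row_mxEr row_mxEl mxE. Qed.

Let rel_r i : rel_diag 0 (rshift q (rshift 1 i)) = 0.
Proof. by rewrite mxE row_mxEr row_mxEr mxE mulr0. Qed.

Let mur : (mu^-1 * r == mu^-1) = false.
Proof.
have /andP[_ r1] := r01.
by rewrite lt_eqF// gtr_pMr// invr_gt0.
Qed.

Let mu_neq0 : (0 == mu^-1) = false.
Proof. by rewrite eq_sym invr_eq0 gt_eqF. Qed.

Lemma rel_diag_cases i :
  [\/ rel_diag 0 i = mu^-1, rel_diag 0 i = mu^-1 * r | rel_diag 0 i = 0].
Proof.
case: (split_ordP i) => [j ->|j ->]; first by rewrite rel_l; constructor 1.
case: (split_ordP j) => [l ->|l ->]; first by rewrite rel_m; constructor 2.
by rewrite rel_r; constructor 3.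
Qed.

Lemma rel_diag_ge0 i : 0 <= rel_diag 0 i.
Proof.
have /andP[r0 _] := r01.
by case: (rel_diag_cases i) => ->; rewrite ?mulr_ge0// ?invr_ge0 ltW.
Qed.

Lemma rel_diag_top : exists i, rel_diag 0 i = mu^-1.
Proof.
have q0 : (0 < q)%N by rewrite truncn_gt0.
by exists (lshift _ (Ordinal q0)); rewrite rel_l.
Qed.

Lemma card_rel_diag_top : #|[pred i | rel_diag 0 i == mu^-1]| = q.
Proof.
rewrite -sum1_card big_mkcond/= big_split_ord/= big_split_ord/=.
rewrite (eq_bigr (fun=> 1%N)); last by move=> i _; rewrite inE rel_l eqxx.
rewrite sum1_card card_ord [X in (_ + (X + _))%N]big1 => [|i _]; last by rewrite inE rel_m mur.
rewrite big1 ?addn0// => i _; by rewrite inE rel_r mu_neq0.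
Qed.

Lemma card_rel_diag_rest :
  #|[pred i | ((rel_diag 0 i != mu^-1) && (rel_diag 0 i != 0))%R]| = (r != 0).
Proof.
rewrite -sum1_card big_mkcond/= big_split_ord/= big_split_ord/=.
rewrite big1 => [|i _]; last by rewrite inE rel_l eqxx.
rewrite add0n big_ord1 inE rel_m mur/= mulf_eq0 invr_eq0 (gt_eqF mu0)/=.
rewrite big1 ?addn0 => [|i _]; first by case: (r != 0).
by rewrite inE rel_r eqxx andbF.
Qed.

(** The only diagonal value besides 0 and the maximum is the fractional entry, and it merges with
    the zero block when [mu] is an integer. *)
Lemma rel_weights m : form_weights m rel_diag 1 mu^-1 =
  if r == 0 then [::] else nseq m (r / (m%:R * mu)).
Proof.
rewrite (@form_weights_nseq _ _ _ _ _ _ (mu^-1 * r)).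
  rewrite card_rel_diag_rest; case: eqVneq => _; first by rewrite muln0.
  by rewrite muln1 mulr1 invfM; congr nseq; rewrite /r; ring.
by move=> i; case: (rel_diag_cases i) => ->; rewrite ?eqxx.
Qed.

End relaxed_matrix.

Lemma gamma_prob_tail (R : realType) (a b eps : R) : 2^-1 <= a -> 0 < b -> 1 < eps ->
  gamma_prob a b [set x | eps <= `|x - 1|] = gamma_law a b `[1 + eps, +oo[%classic.
Proof.
move=> a2 b0 e1.
have mV : measurable [set x : R | eps <= `|x - 1|].
  rewrite (_ : [set x | _] = (fun x : R => `|x - 1|) @^-1` `[eps, +oo[).
    rewrite -[X in measurable X]setTI.
    have mf : measurable_fun setT (fun x : R => `|x - 1|).
      by apply: measurableT_comp => //; exact: measurable_funB.
    exact: mf.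
  by apply/seteqP; split=> x /=; rewrite in_itv/= andbT.
rewrite gamma_probE// !gamma_lawE//; congr (_ * _)%E.
rewrite integral_mkcond [RHS]integral_mkcond; apply: eq_integral => x _.
(* The Gamma weight vanishes for [x <= 0], while the lower deviation would force
   [x <= 1 - eps < 0]. *)
rewrite !patchE; have [x0|x0] := leP x 0.
  by rewrite /gw ltNge x0 /=; do 2 case: ifP.
suff -> : (x \in [set x : R | eps <= `|x - 1|]) = (x \in `[1 + eps, +oo[%classic) by [].
apply/idP/idP; rewrite !inE/= in_itv/= andbT ler_normr.
  by move=> /orP[|]; lra.
by move=> h; apply/orP; left; lra.
Qed.

(** * Comparing eigenvalues with their relaxation and with the Gamma law *)

Section relaxation.
Variables (R : realType) (n m : nat) (dg : 'rV[R]_n) (i0 : 'I_n).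
Hypothesis m_gt0 : (0 < m)%N.
Hypothesis dg_ge0 : forall i, 0 <= dg 0 i.
Hypothesis dg_max : forall i, dg 0 i <= dg 0 i0.
Hypothesis dg_gt0 : 0 < dg 0 i0.

Local Notation D := (dg 0 i0).
Local Notation tau := (\sum_i dg 0 i).
Local Notation mu := (tau / D).
Local Notation q := (Num.truncn mu).
Local Notation r := (mu - q%:R).
Local Notation p := #|[pred i | dg 0 i == D]|.
Local Notation b := (m%:R * mu / 2).
Local Notation sA := (form_weights m dg tau D).
Local Notation sR := (if r == 0 then [::] else nseq m (r / (m%:R * mu))).

Let m0 : 0 < m%:R :> R. Proof. by rewrite ltr0n. Qed.

(** Divided by [D], each of the [p] maximal eigenvalues contributes exactly 1 to [mu]. *)
Lemma sum_rest_eigenvalues :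
  \sum_(i | (dg 0 i != D) && (dg 0 i != 0)) dg 0 i / D = mu - p%:R.
Proof.
rewrite mulr_suml [in RHS](bigID [pred i | dg 0 i == D])/=.
have -> : \sum_(i | dg 0 i == D) dg 0 i / D = p%:R.
  rewrite -sumr_const; apply: eq_big => // i /eqP ->.
  by rewrite divff// gt_eqF.
rewrite [X in _ = _ + X - _](bigID [pred i | dg 0 i != 0])/=.
rewrite [X in _ = _ + (_ + X) - _]big1 => [|i /andP[_]]; last first.
  by rewrite negbK => /eqP ->; rewrite mul0r.
by rewrite addr0 addrC addKr.
Qed.

Let p_gt0 : (0 < p)%N.
Proof. by apply/card_gt0P; exists i0; rewrite inE eqxx. Qed.

Let rest_ge0 : 0 <= mu - p%:R.
Proof.
by rewrite -sum_rest_eigenvalues sumr_ge0// => i _; rewrite divr_ge0// ltW.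
Qed.

Lemma effective_rank_ge1 : 1 <= mu.
Proof.
have : 1 <= p%:R :> R by rewrite ler1n.
by move: rest_ge0; lra.
Qed.

Let mu_gt0 : 0 < mu. Proof. exact: lt_le_trans effective_rank_ge1. Qed.

Let tau_gt0 : 0 < tau.
Proof. by have := mu_gt0; rewrite pmulr_lgt0// invr_gt0. Qed.

Let p_le_q : (p <= q)%N.
Proof. by rewrite truncn_ge_nat ?(ltW mu_gt0)// -subr_ge0. Qed.

Let q_le_mu : q%:R <= mu.
Proof. by have /andP[] := truncn_itv (ltW mu_gt0). Qed.

Let r_ge0 : 0 <= r. Proof. by rewrite subr_ge0. Qed.

Let r_lt1 : r < 1.
Proof. by have /andP[_] := truncn_itv (ltW mu_gt0); rewrite -natr1; lra. Qed.

Let b_gt0 : 0 < b. Proof. by rewrite divr_gt0// mulr_gt0. Qed.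

(** At the critical rate [b] a weight becomes an eigenvalue ratio [d_i], so that its moment is
    [(1 - d_i) ^ (-1/2)], finite as soon as the eigenvalue is not maximal. *)
Let b_rest i : 2 * b * (dg 0 i / (m%:R * tau)) = dg 0 i / D.
Proof. by field; rewrite ?gt_eqF. Qed.

Let b_rel : 2 * b * (r / (m%:R * mu)) = r.
Proof.
have h (x y : R) : 0 < x -> 2 * (m%:R * x / 2) * (y / (m%:R * x)) = y.
  by move=> x0; field; rewrite ?gt_eqF.
exact: h.
Qed.

Let rest01 i : dg 0 i != D -> dg 0 i != 0 -> 0 < dg 0 i / D < 1.
Proof.
move=> iD i0'; have di : 0 < dg 0 i by rewrite lt_def i0' dg_ge0.
by rewrite divr_gt0//= ltr_pdivrMr// mul1r lt_neqAle iD dg_max.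
Qed.

Let good_sA : forall x, x \in sA -> 0 < x /\ 2 * b * x < 1.
Proof.
move=> x /mapP[[j i]]; rewrite mem_filter => /andP[/andP[/= iD i0'] _] ->.
split; first by rewrite divr_gt0 ?mulr_gt0// lt_def i0' dg_ge0.
by rewrite b_rest; have /andP[] := rest01 iD i0'.
Qed.

Let good_sR : forall x, x \in sR -> 0 < x /\ 2 * b * x < 1.
Proof.
move=> x; case: eqVneq => // r0; rewrite mem_nseq => /andP[_ /eqP ->]; split.
  have rp : 0 < r by rewrite lt_def r0 r_ge0.
  by apply: divr_gt0 => //; exact: mulr_gt0.
by rewrite b_rel.
Qed.

Let half_le k : (0 < k)%N -> 2^-1 <= (m * k)%:R / 2 :> R.
Proof.
by move=> k0; rewrite ler_pdivlMr// mulVf// ler1n muln_gt0 m_gt0.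
Qed.

Let q_gt0 : (0 < q)%N. Proof. exact: leq_trans p_le_q. Qed.

Let rest_chi_mgf_lt : p = q ->
  (1 < #|[pred i | ((dg 0 i != D) && (dg 0 i != 0))%R]|)%N ->
  chi_mgf b sA < chi_mgf b sR.
Proof.
move=> pq c1; set P := [pred i | _] in c1.
pose s := [seq dg 0 i / D | i <- enum P].
have s01 y : y \in s -> 0 < y < 1.
  by move=> /mapP[i]; rewrite mem_enum => /andP[iD i0'] ->; exact: rest01.
have ss : (1 < size s)%N by rewrite size_map -cardE.
have := prod_onem_gt s01 ss.
rewrite /s !big_map !big_enum/= sum_rest_eigenvalues pq => lt_prod.
(* With [r = 0] the ratios, all positive, would sum to 0, although there are at least two of
   them. *)
have r0 : r != 0.
  apply: contraTneq ss => r0; rewrite -leqNgt size_map -cardE.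
  rewrite (eq_card0 (A := P))// => i; apply/negbTE/negP => Pi.
  have /andP[iD i0'] := Pi.
  have := sum_rest_eigenvalues; rewrite pq r0 => /eqP.
  rewrite psumr_eq0 => [|j _]; last by rewrite divr_ge0// ltW.
  move=> /allP/(_ i (mem_index_enum _)); rewrite iD i0'/= => /eqP h.
  by have := rest01 iD i0'; rewrite h ltxx.
rewrite (negbTE r0) chi_mgf_nseq chi_mgf_form_weights.
rewrite prod_sqrt_geom => [|i /andP[iD i0']]; last first.
  by rewrite b_rest; have /andP[] := rest01 iD i0'.
under eq_bigr do rewrite b_rest.
rewrite /sqrt_geom b_rel.
have rp : 0 < 1 - r by rewrite subr_gt0.
rewrite ltrXn2r -?lt0n// ?nnegrE ?powR_ge0//.
by rewrite gt0_ltr_powR ?invr_gt0// ?nnegrE ?invr_ge0 ?(ltW rp)// ?ltf_pV2//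
  ?posrE ?(ltW (lt_trans rp lt_prod))// (lt_trans rp).
Qed.

(** For [p < q] the shape decides. For [p = q] the moments decide if two or more eigenvalues remain;
    otherwise the two lists of weights are the same. *)
Lemma tail_le_relaxed : exists t0, forall t, t0 <= t ->
  (Ftail ((m * p)%:R / 2) b sA t <= Ftail ((m * q)%:R / 2) b sR t)%E.
Proof.
have [pq|pq|pq] := ltngtP p q; first last.
- have [c1|c1] := leqP #|[pred i | ((dg 0 i != D) && (dg 0 i != 0))%R]| 1.
    (* A single remaining eigenvalue must have ratio [r], and if none remains then [r = 0]: the laws
       coincide and every threshold works. *)
    exists 0 => t _; rewrite pq; suff -> : sA = sR by [].
    move: c1; rewrite leq_eqVlt ltnS leqn0 => /orP[/eqP c1|/eqP c0].
      have /card1P/=[i Pi] : #|[pred i | ((dg 0 i != D) && (dg 0 i != 0))%R]| == 1%N.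
        by rewrite c1.
      have : (i \in pred1 i) by rewrite inE.
      rewrite -Pi inE => /andP[iD i0'].
      have ry : dg 0 i / D = r.
        by rewrite -pq -sum_rest_eigenvalues (big_pred1 i).
      have r0 : r != 0 by rewrite -ry mulf_neq0// invr_eq0 gt_eqF.
      rewrite (negbTE r0) (@form_weights_nseq _ _ _ _ _ _ (dg 0 i)).
        by rewrite c1 muln1 -ry; congr nseq; field; rewrite !gt_eqF.
      move=> j jD j0; suff /eqP -> : j == i by [].
      by have := Pi j; rewrite !inE jD j0.
    have Pi i : (dg 0 i != D) && (dg 0 i != 0) = false.
      by have := card0_eq c0 i; rewrite inE.
    have -> : r = 0 by rewrite -pq -sum_rest_eigenvalues big_pred0.
    rewrite eqxx (@form_weights_nseq _ _ _ _ _ _ 0).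
      by rewrite c0 muln0.
    by move=> i iD i0'; have := Pi i; rewrite iD i0'.
  rewrite pq; apply: Ftail_same_exponent => //; first exact: half_le.
  exact: rest_chi_mgf_lt.
- by move: p_le_q; rewrite leqNgt pq.
apply: Ftail_lt_exponent => //; first exact: half_le.
by rewrite ltr_pM2r ?invr_gt0// ltr_nat ltn_mul2l m_gt0.
Qed.

(** If [mu] is an integer both sides are the same Gamma tail. Otherwise the shape [m q / 2] is
    strictly below [m mu / 2], and the right side is the case of an empty list of weights. *)
Lemma relaxed_tail_le_gamma : exists t0, forall t, t0 <= t ->
  (Ftail ((m * q)%:R / 2) b sR t <= gamma_law b b `[t, +oo[%classic)%E.
Proof.
case: (eqVneq r 0) => [r0|r0].
  exists 0 => t _; rewrite /Ftail [csum _]/= dirac_addge natrM.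
  by move/eqP: r0; rewrite subr_eq0 => /eqP <-.
have [|||||t0 ht] := @Ftail_lt_exponent R ((m * q)%:R / 2) b b sR [::].
- exact: half_le.
- rewrite ltr_pM2r ?invr_gt0// natrM ltr_pM2l//.
  by rewrite lt_neqAle q_le_mu andbT eq_sym -subr_eq0.
- exact: b_gt0.
- exact: good_sR.
- by [].
exists t0 => t /ht; rewrite (negbTE r0) => /le_trans; apply.
by rewrite /Ftail [csum [::]]/= dirac_addge.
Qed.

End relaxation.
Theorem theorem6 (R : realType) (n m : nat) (A : 'M[R]_n) :
  sym_psd A -> A != 0 -> (0 < m)%N ->
  exists eps_rel : R, forall eps : R, eps_rel <= eps ->
    forall (k : nat)
      (d1 : measure_display) (T1 : measurableType d1) (P1 : probability T1 R)
      (z1 : 'I_m * 'I_n -> {RV P1 >-> R}),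
    iid_std_gaussian z1 ->
    forall (d2 : measure_display) (T2 : measurableType d2) (P2 : probability T2 R)
      (z2 : 'I_m * 'I_(Num.truncn (eff_rank A) + (1 + k)) -> {RV P2 >-> R}),
    iid_std_gaussian z2 ->
    (P1 [set w | (eps * \tr A <= `| trG A (sample_vec z1 w) - \tr A |)%R]
       <= P2 [set w | (eps <= `| trG (A_rel (eff_rank A) k) (sample_vec z2 w) - 1 |)%R])%E
    /\
    (P2 [set w | (eps <= `| trG (A_rel (eff_rank A) k) (sample_vec z2 w) - 1 |)%R]
       <= gamma_prob (m%:R * eff_rank A / 2)%R (m%:R * eff_rank A / 2)%R
            [set x | (eps <= `| x - 1 |)%R])%E.
Proof.
move=> [A_sym A_psd] A_neq0 m_gt0.
have [G [gG [dg GA]]] := givens_spectral A_sym.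
have dg_ge0 i : 0 <= dg 0 i by exact: (givens_psd GA).
have [i1 di1] : exists i, dg 0 i != 0.
  apply/existsP; apply: contraNT A_neq0; rewrite negb_exists => /forallP dg0.
  have {}dg0 : dg = 0 by apply/rowP => i; rewrite mxE; apply/eqP; have := dg0 i; rewrite negbK.
  have GG : G^T *m G = 1%:M by exact: givens_prod_orth.
  have -> : A = G^T *m (G *m A *m G^T) *m G.
    by rewrite !mulmxA GG mul1mx -mulmxA GG mulmx1.
  by rewrite GA dg0 linear0 mulmx0 mul0mx.
have [i0 dg_max] : exists i0, forall i, dg 0 i <= dg 0 i0.
  by exists [arg max_(i > i1) dg 0 i]%O; case: arg_maxP => // i _ h j; exact: h.
have dg_gt0 : 0 < dg 0 i0.
  by rewrite (lt_le_trans _ (dg_max i1))// lt_def di1 dg_ge0.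
have trE := trace_givens gG GA.
have mu1 := effective_rank_ge1 dg_ge0 dg_gt0.
have effE : eff_rank A = (\sum_i dg 0 i) / dg 0 i0.
  by rewrite /eff_rank trE (spec_norm_givens gG GA (i0 := i0)).
have [t1 tail1] := tail_le_relaxed m_gt0 dg_ge0 dg_max dg_gt0.
have [t2 tail2] := relaxed_tail_le_gamma m_gt0 dg_ge0 dg_gt0.
(* The bound 2 ensures [eps > 1]. The tails are compared at [1 + eps], so [eps >= t1] and
   [eps >= t2] are more than enough. *)
exists (Num.max 2 (Num.max t1 t2)) => eps; rewrite !ge_max => /and3P[eps2 et1 et2].
move=> k d1 T1 P1 z1 z1G; rewrite trE effE.
set mu := (\sum_i dg 0 i) / dg 0 i0 in mu1 tail1 tail2 *.
move=> d2 T2 P2 z2 z2G.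
have eps1 : 1 < eps by lra.
have mu0 : 0 < mu by lra.
have m0 : 0 < m%:R :> R by rewrite ltr0n.
have tau0 : 0 < \sum_i dg 0 i by move: mu0; rewrite /mu pmulr_lgt0// invr_gt0.
have m1 : 1 <= m%:R :> R by rewrite ler1n.
have PA : P1 [set w | (eps * \sum_i dg 0 i <= `|trG A (sample_vec z1 w) - \sum_i dg 0 i|)%R] =
  Ftail ((m * #|[pred i | dg 0 i == dg 0 i0]|)%:R / 2) (m%:R * mu / 2)
    (form_weights m dg (\sum_i dg 0 i) (dg 0 i0)) (1 + eps).
  rewrite (_ : m%:R * mu / 2 = m%:R * (\sum_i dg 0 i) / (2 * dg 0 i0)); last first.
    by rewrite /mu; field; rewrite gt_eqF.
  by apply: (quadratic_form_tail gG GA) => //; exists i0.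
have PR : P2 [set w | (eps <= `|trG (A_rel mu k) (sample_vec z2 w) - 1|)%R] =
  Ftail ((m * Num.truncn mu)%:R / 2) (m%:R * mu / 2)
    (if mu - (Num.truncn mu)%:R == 0 then [::]
     else nseq m ((mu - (Num.truncn mu)%:R) / (m%:R * mu))) (1 + eps).
  rewrite -(rel_weights k mu1) -[X in Ftail ((m * X)%:R / 2)](card_rel_diag_top k mu1).
  rewrite (_ : m%:R * mu / 2 = m%:R * 1 / (2 * mu^-1)); last first.
    by field; rewrite gt_eqF.
  rewrite -[in LHS](mulr1 eps).
  (* The matrix is already diagonal, so the empty product of rotations diagonalizes it; its trace 1
     plays the part of [tau]. *)
  have A1 : 1%:M *m A_rel mu k *m 1%:M^T = diag_mx (rel_diag mu k).
    by rewrite trmx1 mulmx1 mul1mx A_rel_diag.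
  apply: (quadratic_form_tail (givens_prod1 _ _) A1) => //.
  - by move=> i; exact: rel_diag_ge0.
  - by rewrite invr_gt0.
  - exact: rel_diag_top.
split.
  by rewrite PA PR; apply: tail1; lra.
rewrite PR gamma_prob_tail//; first by apply: tail2; lra.
- by rewrite ler_pdivlMr// mulVf// mulr_ege1.
- by rewrite divr_gt0// mulr_gt0.
Qed.
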